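(* Let $m\ge 1$ and let $X_{1},\ldots,X_{n}$ be independent, identically distributed random variables with the $m$-component normal mixture density $f(x)=\sum_{j=1}^{m}w_{j}\,\sigma_j^{-1}\phi((x-\mu_{j})/\sigma_{j})$, where $-\infty<\mu_{j}<\infty$, $\sigma_{j}>0$, $w_{j}>0$ for all $j$, and $\sum_{j=1}^{m}w_{j}=1$; let $F$ be the corresponding distribution function. Let $k(z)=\frac12\mathbf{1}\{-1\leq z\leq 1\}$ be the uniform kernel, $K(z)=\int_{-\infty}^{z}k(x)\,\mathrm{d}x$, and $\widehat{F}(x;h)=\frac{1}{n}\sum_{i=1}^{n}K((x-X_{i})/h)$. Then for every $h>0$, $$\mathrm{ISB}[\widehat{F}(\cdot;h)]=-\frac{1}{2h^{2}}\left[J(2h;-4)-J(0;-4)\right]+\frac{2}{h}J(h;-3)-\frac{\sigma_{f}^{2}}{2h}-\frac{h}{6}-J(0;-2),$$ $$\mathrm{IV}[\widehat{F}(\cdot;h)]=-\frac{2h}{3n}+\frac{1}{2h^{2}n}\left[J(2h;-4)-J(0;-4)\right]-\frac{\sigma_{f}^{2}}{2hn},$$ where $$J(x;p)=\sum_{i=1}^{m}\sum_{j=1}^{m}w_{i}w_{j}\,\phi^{(p)}(x;\mu_{i}-\mu_{j},\sigma_{ij,0}^{2}),\qquad \sigma_{ij,0}^{2}=\sigma_{i}^{2}+\sigma_{j}^{2},$$ and $\sigma_{f}^{2}=\sum_{i=1}^{m}w_{i}(\mu_{i}^{2}+\sigma_{i}^{2})-\left(\sum_{i=1}^{m}w_{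i}\mu_{i}\right)^{2}$.
   Context: $\phi$ and $\Phi$ are the standard normal density and distribution function. For negative integers $p$, $\phi^{(p)}$ denotes the iterated antiderivative of $\phi$ vanishing at $-\infty$: $\phi^{(-1)}(x)=\Phi(x)$, $\phi^{(-2)}(x)=\phi(x)+x\Phi(x)$, $\phi^{(-3)}(x)=x\phi(x)/2+(x^{2}+1)\Phi(x)/2$, $\phi^{(-4)}(x)=(x^{2}+2)\phi(x)/6+(x^{3}+3x)\Phi(x)/6$. With location $\mu$ and variance $\sigma^{2}$ ($\sigma>0$), $\phi^{(p)}(x;\mu,\sigma^{2})=\phi^{(p)}((x-\mu)/\sigma)/\sigma^{p+1}$. $\mathrm{ISB}[\widehat{F}(\cdot;h)]=\int_{-\infty}^{\infty}\{\mathrm{E}[\widehat{F}(x;h)]-F(x)\}^{2}\,\mathrm{d}x$ is the integrated squared bias and $\mathrm{IV}[\widehat{F}(\cdot;h)]=\int_{-\infty}^{\infty}\mathrm{Var}[\widehat{F}(x;h)]\,\mathrm{d}x$ is the integrated variance. *)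

(* Defs.v *)
From HB Require Import structures.
From mathcomp Require Import all_boot all_order all_algebra.
From mathcomp Require Import all_classical all_reals all_analysis.

Set Implicit Arguments.
Unset Strict Implicit.
Unset Printing Implicit Defensive.

Import Order.TTheory GRing.Theory Num.Theory.
Import numFieldNormedType.Exports.

Local Open Scope classical_set_scope.
Local Open Scope ring_scope.

Definition normal_phi {R : realType} (x : R) : R := normal_pdf 0 1 x.

(* The antiderivative of [g] vanishing at -oo, for [g] integrable on every
   half-line ]-oo, x]. *)
Definition antiderivative {R : realType} (g : R -> R) (x : R) : R :=
  \int[lebesgue_measure]_(t in `]-oo, x]) g t.

(* [Negz k] is the integer -(k + 1). *)
Definition normal_phi_iter {R : realType} (p : int) : R -> R :=
  match p with
  | Posz k => derive1n k normal_phi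
  | Negz k => iter k.+1 antiderivative normal_phi
  end.

(* The second parameter [v] is the variance, not the standard deviation. *)
Definition normal_phi_iter_scaled {R : realType} (p : int) (x m v : R) : R :=
  normal_phi_iter p ((x - m) / Num.sqrt v) / Num.sqrt v ^ (p + 1).

Definition mixture_pdf {R : realType} m (w mu sigma : 'I_m -> R) (x : R) : R :=
  \sum_(j < m) w j * ((sigma j)^-1 * normal_phi ((x - mu j) / sigma j)).

Definition mixture_cdf {R : realType} m (w mu sigma : 'I_m -> R) : R -> R :=
  antiderivative (mixture_pdf w mu sigma).

Definition mixture_var {R : realType} m (w mu sigma : 'I_m -> R) : R :=
  \sum_(i < m) w i * (mu i ^+ 2 + sigma i ^+ 2) - (\sum_(i < m) w i * mu i) ^+ 2.

Definition mixture_J {R : realType} m (w mu sigma : 'I_m -> R) (x : R) (p : int)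
    : R :=
  \sum_(i < m) \sum_(j < m)
    w i * w j *
    normal_phi_iter_scaled p x (mu i - mu j) (sigma i ^+ 2 + sigma j ^+ 2).

Definition unif_kernel {R : realType} (z : R) : R := 2^-1 * \1_(`[-1, 1]) z.

Definition unif_kernel_cdf {R : realType} : R -> R := antiderivative unif_kernel.

Section probability.
Context d (T : measurableType d) (R : realType) (P : probability T R).

Definition has_density (X : {RV P >-> R}) (f : R -> R) : Prop :=
  forall A : set R, measurable A ->
    distribution P X A = (\int[lebesgue_measure]_(x in A) (f x)%:E)%E.

Definition mutually_independent (I : finType) (X : I -> {RV P >-> R}) : Prop :=
  forall (B : {set I}) (A : I -> set R), (forall i, measurable (A i)) ->
    P (\bigcap_(i in [set` B]) X i @^-1` A i) =
    (\prod_(i in B) P (X i @^-1` A i))%E.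

Definition kernel_cdf_estimator n (X : 'I_n -> {RV P >-> R}) (h x : R) (t : T)
    : R :=
  n%:R^-1 * \sum_(i < n) unif_kernel_cdf ((x - X i t) / h).

Definition ISB (Fhat : R -> T -> R) (F : R -> R) : \bar R :=
  (\int[lebesgue_measure]_x (('E_P[Fhat x] - (F x)%:E) ^+ 2))%E.

Definition IV (Fhat : R -> T -> R) : \bar R :=
  (\int[lebesgue_measure]_x 'V_P[Fhat x])%E.

End probability.

(* Main.v *)
Require Import Defs.
From HB Require Import structures.
From mathcomp Require Import all_boot all_order all_algebra.
From mathcomp Require Import all_classical all_reals all_analysis.
From mathcomp Require Import measurable_realfun normal_distribution ring lra.

(* Let [K] be the distribution function of the uniform law on [[-h, h]], let [X]
   and [Y] be independent with density [f], and put [A x = E K(x - X)], so that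
   [1 - A x = E K(X - x)].  Then
     [(A - F)^2 = A (1 - F) + F (1 - A) - A (1 - A) - F (1 - F)],
   and by Tonelli the integral of each of the four products is [E C(Y - X)],
   where [C] is the convolution of two functions among [K] and the indicator of
   [[0, +oo[], hence a combination of shifted truncated powers of degree at most
   3.  By completing the square, [Y - X] is the normal mixture with components
   [N(mu_i - mu_j, sigma_i^2 + sigma_j^2)], and its [k]-th truncated moment at
   [x] is [k! J(x; -(k + 1))]; truncated powers of [t - a] are turned into those
   of [a - t] using the symmetry of [Y - X] and its second moment.
   The variance of the estimator is [n^-1 (E K(x - X)^2 - (A x)^2)], which is
   [n^-1 (A (1 - A) - E (K (1 - K)) (x - X))]. *)

Set Implicit Arguments.
Unset Strict Implicit.
Unset Printing Implicit Defensive.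

Import Order.TTheory GRing.Theory Num.Theory.
Import numFieldNormedType.Exports.

Local Open Scope classical_set_scope.
Local Open Scope ring_scope.

(** * Affine and reflected substitutions in nonnegative Lebesgue integrals *)

Section change_of_variables.
Context {R : realType}.
Local Notation mu := (@lebesgue_measure R).

(** Lebesgue measure equals [s] times its pushforward under [x -> a + s * x], because the two agree
    on half-open intervals: the preimage of []b, c]] has length [(c - b) / s]. *)
Lemma ge0_integral_affine (a s : R) (G : R -> \bar R) :
  0 < s -> measurable_fun [set: R] G -> (forall x, (0 <= G x)%E) ->
  (\int[mu]_x G x = s%:E * \int[mu]_x G (a + s * x)%R)%E.
Proof.
move=> s_gt0 mG G0.
have mphi : measurable_fun [set: measurableTypeR R]
    (fun x => a + s * x : measurableTypeR R).
  by apply: measurable_funD => //; exact: measurable_funM.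
pose phi : {mfun measurableTypeR R >-> measurableTypeR R} :=
  HB.pack (fun x => a + s * x : R) (isMeasurableFun.Build _ _ _ _ _ mphi).
have -> : (\int[mu]_x G (a + s * x)%R = \int[pushforward mu phi]_x G x)%E.
  by rewrite ge0_integral_pushforward.
rewrite -(@ge0_integral_mscale _ _ _ (pushforward mu phi) _ _
  (NngNum (ltW s_gt0)))//.
apply: eq_measure_integral => A mA _.
apply: lebesgue_measure_unique => //= _ [[b c]] _ <-.
rewrite /mscale/= /pushforward.
rewrite (_ : _ @^-1` _ = `](b - a) / s, (c - a) / s]%classic); last first.
  apply/seteqP; split => x /=; rewrite !in_itv/= ltr_pdivrMr// ler_pdivlMr//;
  by rewrite ltrBlDl lerBrDl (mulrC x).
rewrite !lebesgue_measure_itv/= !lte_fin ltr_pM2r ?invr_gt0// ltrD2r.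
case: ifPn => _; last by rewrite mule0.
by rewrite -!EFinD -EFinM; congr EFin; field; rewrite gt_eqF.
Qed.

Lemma ge0_integral_opp (G : R -> \bar R) :
  measurable_fun [set: R] G -> (forall x, (0 <= G x)%E) ->
  (\int[mu]_x G (- x)%R = \int[mu]_x G x)%E.
Proof.
move=> mG G0.
have mphi : measurable_fun [set: measurableTypeR R] (-%R : _ ->
  measurableTypeR R).
  exact: oppr_measurable.
rewrite -(@ge0_integral_pushforward _ _
  (measurableTypeR R) _ _ _ mphi mu setT)//.
by apply: eq_measure_integral => A mA _; exact: lebesgue_measureN.
Qed.

End change_of_variables.

(** * Integrability bundled with a real value *)

Section has_integral.
Context {R : realType}.
Local Notation mu := (@lebesgue_measure R).
Implicit Types F G : R -> R.

(** Carrying integrability along with a real value lets sums, differences and multiples be computed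
    in [R], with no side condition on infinite values. *)
Definition has_integral F (a : R) :=
  mu.-integrable [set: R] (EFin \o F) /\ (\int[mu]_x (F x)%:E = a%:E)%E.

Lemma has_integral_measurable F a :
  has_integral F a -> measurable_fun [set: R] F.
Proof. by case=> /measurable_int/measurable_EFinP. Qed.

Lemma Rintegral_has_integral F a : has_integral F a -> \int[mu]_x F x = a.
Proof. by rewrite /Rintegral => -[_ ->]. Qed.

Lemma integrable_has_integral F : mu.-integrable [set: R] (EFin \o F) ->
  has_integral F (\int[mu]_x F x).
Proof.
by move=> iF; split => //; rewrite fineK//; exact: integrable_fin_num.
Qed.

Lemma ge0_has_integral F a : measurable_fun [set: R] F ->
  (forall x, 0 <= F x) ->
  (\int[mu]_x (F x)%:E = a%:E)%E -> has_integral F a.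
Proof.
move=> mF F0 Fa; split => //; apply/integrableP; split.
  exact/measurable_EFinP.
under eq_integral do rewrite /= ger0_norm//.
by rewrite Fa ltry.
Qed.

Lemma has_integral_eq F G a b : F =1 G -> a = b ->
  has_integral F a -> has_integral G b.
Proof. by move=> /funext -> ->. Qed.

Lemma has_integral_uniq F a b : has_integral F a -> has_integral F b -> a = b.
Proof. by move=> [_ Fa] [_]; rewrite Fa => -[]. Qed.

Lemma has_integralD F G a b : has_integral F a -> has_integral G b ->
  has_integral (fun x => F x + G x) (a + b).
Proof.
move=> [iF Fa] [iG Gb]; split; first exact: integrableD iF iG.
by rewrite EFinD -Fa -Gb -integralD_EFin.
Qed.

Lemma has_integralZ F a c : has_integral F a ->
  has_integral (fun x => c * F x) (c * a).
Proof.
move=> [iF Fa]; split; first exact: (integrableZl measurableT c iF).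
by under eq_integral do rewrite EFinM; rewrite integralZl// Fa.
Qed.

Lemma has_integralB F G a b : has_integral F a -> has_integral G b ->
  has_integral (fun x => F x - G x) (a - b).
Proof.
move=> Fa /(has_integralZ (-1)) Gb.
by apply: has_integral_eq (has_integralD Fa Gb) => [x|]; rewrite mulN1r.
Qed.

Lemma has_integral_sum (I : Type) (s : seq I) (F : I -> R -> R) (a : I -> R) :
  (forall i, has_integral (F i) (a i)) ->
  has_integral (fun x => \sum_(i <- s) F i x) (\sum_(i <- s) a i).
Proof.
move=> Fa; elim: s => [|i s ih].
  apply: (@has_integral_eq (cst 0) _ 0); last 1 first.
  - by split; [exact: integrable0|rewrite integral0].
  - by move=> x; rewrite big_nil.
  - by rewrite big_nil.
apply: has_integral_eq (has_integralD (Fa i) ih) => [x|]; by rewrite big_cons.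
Qed.

(* Writing [F] as [(F + |F|) - |F|] reduces a change of variables for [F] to the
   nonnegative case. *)
Lemma has_integral_change (u : R -> R) c F a : measurable_fun [set: R] u ->
  (forall G b, (forall x, 0 <= G x) -> has_integral G b ->
    has_integral (G \o u) (c * b)) ->
  has_integral F a -> has_integral (F \o u) (c * a).
Proof.
move=> mu_ ge0 Fa.
have nF : has_integral (fun x => `|F x|) (\int[mu]_x `|F x|).
  apply: integrable_has_integral; case: Fa => iF _.
  exact: (integrable_norm iF).
apply: has_integral_eq (has_integralB (ge0 _ _ _ (has_integralD Fa nF))
   (ge0 _ _ _ nF)) => [x| |x|x] //=.
- by rewrite addrK.
- by rewrite -mulrBr addrK.
- by have := ler_norm (- F x); rewrite normrN; lra.
Qed.

Lemma has_integral_opp F a : has_integral F a ->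
  has_integral (fun x => F (- x)) a.
Proof.
rewrite -{2}(mul1r a); apply: has_integral_change; first exact: oppr_measurable.
move=> G b G0 Gb; have mG := has_integral_measurable Gb.
rewrite mul1r; apply: ge0_has_integral => [|x|]/=; last 2 first.
- exact: G0.
- rewrite (@ge0_integral_opp _ (EFin \o G))//; first by case: Gb.
  exact/measurable_EFinP.
by apply: measurableT_comp => //; exact: oppr_measurable.
Qed.

Lemma has_integral_affine m s F a : 0 < s -> has_integral F a ->
  has_integral (fun x => F (m + s * x)) (s^-1 * a).
Proof.
move=> s0; have mu_ : measurable_fun [set: R] (fun x => m + s * x).
  by apply: measurable_funD => //; exact: measurable_funM.
apply: has_integral_change => // G b G0 Gb.
have mG := has_integral_measurable Gb.
apply: ge0_has_integral => [|x|]/=; first exact: measurableT_comp.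
  exact: G0.
have := @ge0_integral_affine _ m s (EFin \o G) s0.
rewrite (_ : (\int[mu]_x (EFin \o G) x)%E = b%:E); last by case: Gb.
move=> /=; rewrite EFinM => ->//; last exact/measurable_EFinP.
by rewrite muleA -EFinM mulVf ?gt_eqF// mul1e.
Qed.

End has_integral.

(** * Truncated powers and their elementary integrals *)

Section truncated_power.
Context {R : realType}.
Local Notation mu := (@lebesgue_measure R).

(* The truncated power; since [u ^+ 0 = 1], [tpow 0] is the indicator of
   [[0, +oo[]. *)
Definition tpow (k : nat) (u : R) : R := if 0 <= u then u ^+ k else 0.

Lemma tpow_ge0 k u : 0 <= tpow k u.
Proof. by rewrite /tpow; case: ifPn => // u0; exact: exprn_ge0. Qed.

Lemma measurable_tpow k : measurable_fun [set: R] (tpow k).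
Proof.
by apply: measurable_fun_ifT => //=; exact: measurable_fun_ler.
Qed.

Lemma tpow_le k u : tpow k u <= `|u| ^+ k.
Proof.
rewrite /tpow; case: ifPn => [u0|_]; first by rewrite ger0_norm.
exact: exprn_ge0.
Qed.

(** Away from the origin exactly one of the two truncated powers is nonzero. The exponent is
    positive because at [u = 0] two indicators would add up to 2. *)
Lemma tpow_opp k (u : R) : u ^+ k.+1 =
  tpow k.+1 u + (-1) ^+ k.+1 * tpow k.+1 (- u).
Proof.
rewrite /tpow oppr_ge0; have [u0|u0|->] := ltgtP u 0.
- by rewrite add0r -exprMn mulN1r opprK.
- by rewrite mulr0 addr0.
- by rewrite oppr0 !expr0n/= mulr0 addr0.
Qed.

Lemma tpow1_gt0 u : 0 < u -> tpow 1 u = u.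
Proof. by move=> u0; rewrite /tpow ltW. Qed.

Lemma tpow1_le0 u : u <= 0 -> tpow 1 u = 0.
Proof.
by rewrite /tpow; case: ltgtP => // <-; rewrite expr1.
Qed.

(** The fundamental theorem of calculus on [[0, t]] with a polynomial antiderivative; for [t < 0]
    the interval is empty, whence the value 0. *)
Lemma has_integral_poly_itv (t : R) (H : R -> R) (p : {poly R}) :
  (forall u, 0 <= H u) ->
  (forall u, H u = if (0 <= u) && (u <= t) then p^`().[u] else 0) ->
  has_integral H (if 0 <= t then p.[t] - p.[0] else 0).
Proof.
move=> H0 HE.
have HP : H = horner p^`() \_ `[0, t].
  by apply/funext => u; rewrite patchE HE mem_setE in_itv.
apply: ge0_has_integral => //.
  rewrite HP; apply/measurable_restrict => //; rewrite setTI.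
  by apply: measurable_funTS; apply: continuous_measurable_fun;
    exact: continuous_horner.
have -> : (\int[mu]_x (H x)%:E = \int[mu]_(x in `[0%R, t]) (p^`().[x])%:E)%E.
  by rewrite [RHS]integral_mkcond HP;
    under [RHS]eq_integral do rewrite restrict_EFin.
case: ltgtP => [t0|t0|<-].
- rewrite (@continuous_FTC2 _ _ (horner p))//.
  + by apply: continuous_subspaceT; exact: continuous_horner.
  + split.
    * by move=> x _; exact: derivable_horner.
    * by apply: cvg_at_right_filter; exact: continuous_horner.
    * by apply: cvg_at_left_filter; exact: continuous_horner.
  + by move=> x _; rewrite derivE.
- by rewrite set_itv_ge ?bnd_simp -?ltNge// integral_set0.
- by rewrite set_itv1 integral_set1 subrr.
Qed.

Lemma has_integral_tpow_tpow0 k (t : R) :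
  has_integral (fun u => tpow k u * tpow 0 (t - u)) (tpow k.+1 t / k.+1%:R).
Proof.
have := @has_integral_poly_itv t (fun u => tpow k u * tpow 0 (t - u))
  (k.+1%:R^-1 *: 'X^(k.+1)).
rewrite !hornerE expr0n/= mulr0 subr0 => H.
apply: has_integral_eq (H _ _) => [//||u|u].
- by rewrite /tpow; case: ifP => _; rewrite ?mul0r// mulrC.
- by rewrite mulr_ge0 ?tpow_ge0.
- rewrite /tpow subr_ge0 derivZ derivXn !hornerE; case: ifP => _;
  last by rewrite mul0r.
  case: ifP => _; last by rewrite mulr0.
  by rewrite mulr1 hornerMn hornerXn -[u ^+ _ *+ _]mulr_natl mulKf ?pnatr_eq0.
Qed.

(** On [[0, t]] the integrand is [u * (t - u)], with antiderivative [t * u^2 / 2 - u^3 / 3], which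
    is [t^3 / 6] at [t]. *)
Lemma has_integral_tpow1_tpow1 (t : R) :
  has_integral (fun u => tpow 1 u * tpow 1 (t - u)) (tpow 3 t / 6).
Proof.
have := @has_integral_poly_itv t (fun u => tpow 1 u * tpow 1 (t - u))
  ((t / 2) *: 'X^2 - 3^-1 *: 'X^3).
rewrite !hornerE/= => H.
apply: has_integral_eq (H _ _) => [//||u|u].
- by rewrite /tpow; case: ifP => _; [field|rewrite mul0r].
- by rewrite mulr_ge0 ?tpow_ge0.
- rewrite /tpow subr_ge0 derivB !derivZ !derivXn !hornerE; case: ifP => _;
  last by rewrite mul0r.
  case: ifP => _; last by rewrite mulr0.
  by rewrite ?hornerMn ?hornerXn /=; field.
Qed.

End truncated_power.

(** * Convolutions of step functions, ramps and uniform distribution functions *)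

Section convolution.
Context {R : realType}.
Implicit Types (F G C : R -> R) (h t u : R).

(** A relation rather than an operation, so that a convolution is given in closed form and
    integrability at every [t] is part of the claim. *)
Definition is_convolution F G C :=
  forall t, has_integral (fun u => F u * G (t - u)) (C t).

Lemma is_convolution_sym F G C : is_convolution F G C -> is_convolution G F C.
Proof.
move=> FG t; have := has_integral_affine (- t) ltr01 (has_integral_opp (FG t)).
apply: has_integral_eq => [u|]; last by rewrite invr1 mul1r.
by rewrite mul1r opprD !opprK subKr mulrC.
Qed.

Lemma is_convolution_shift F G C a : is_convolution F G C ->
  is_convolution (fun u => F (u + a)) G (fun t => C (t + a)).
Proof.
move=> FG t; have := has_integral_affine a ltr01 (FG (t + a)).
apply: has_integral_eq => [u|]; last by rewrite invr1 mul1r.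
by congr (F _ * G _); ring.
Qed.

Lemma is_convolutionZB F1 F2 G C1 C2 c :
  is_convolution F1 G C1 -> is_convolution F2 G C2 ->
  is_convolution (fun u => (F1 u - F2 u) * c) G (fun t => (C1 t - C2 t) * c).
Proof.
move=> F1G F2G t; have := has_integralZ c (has_integralB (F1G t) (F2G t)).
by apply: has_integral_eq => [u|]; ring.
Qed.

Lemma is_convolution_eq F G C1 C2 : C1 =1 C2 ->
  is_convolution F G C1 -> is_convolution F G C2.
Proof. by move=> /funext ->. Qed.

Lemma tpow0_tpow0 : is_convolution (tpow 0) (tpow 0) (@tpow R 1).
Proof.
by move=> t; apply: has_integral_eq (has_integral_tpow_tpow0 0 t);
  rewrite ?divr1.
Qed.

(* The distribution function of the uniform law on [[-h, h]]. *)
Definition box_cdf h u : R := (tpow 1 (u + h) - tpow 1 (u - h)) / (2 * h).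

(** [box_cdf h] is a normalized difference of two shifts of [tpow 1], and convolution is linear and
    commutes with shifts. *)
Lemma box_cdf_convolution G C h : is_convolution (tpow 1) G C ->
  is_convolution (box_cdf h) G (fun t => (C (t + h) - C (t - h)) / (2 * h)).
Proof. by move=> TG; apply: is_convolutionZB; exact: is_convolution_shift. Qed.

Lemma box_cdf_tpow0 h : is_convolution (box_cdf h) (tpow 0)
  (fun t => (tpow 2 (t + h) - tpow 2 (t - h)) / (4 * h)).
Proof.
have := @box_cdf_convolution (tpow 0) (fun t => tpow 2 t / 2) h.
move=> /(_ (fun t => has_integral_tpow_tpow0 1 t)).
apply: is_convolution_eq => t; rewrite -mulrBl -mulrA -invfM.
by congr (_ / _); ring.
Qed.

(** By symmetry the ramp [tpow 1] can be replaced by [box_cdf h] in each factor in turn. This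
    produces a second difference of [tpow 3 / 6] with step [2 * h], and [24 * h ^+ 2] is
    [6 * (2 * h) ^+ 2]. *)
Lemma box_cdf_box_cdf h : is_convolution (box_cdf h) (box_cdf h)
  (fun t => (tpow 3 (t + 2 * h) - 2 * tpow 3 t + tpow 3 (t - 2 * h)) /
            (24 * h ^+ 2)).
Proof.
have := box_cdf_convolution h (is_convolution_sym
  (box_cdf_convolution h (@has_integral_tpow1_tpow1 R))).
apply: is_convolution_eq => t.
rewrite addrK subrK -mulr_natl -addrA -mulr2n -mulr_natl -addrA -opprD -mulr2n.
rewrite -(mulr_natl h) -!mulrBl -!mulrA -!invfM.
congr (_ / _); ring.
Qed.

Lemma measurable_box_cdf h : measurable_fun [set: R] (box_cdf h).
Proof.
apply: measurable_funM => //; apply: measurable_funB;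
  by apply: measurableT_comp; [exact: measurable_tpow|exact: measurable_funD].
Qed.

Lemma box_cdfE h u : 0 < h -> box_cdf h u =
  if u <= - h then 0 else if u <= h then (u + h) / (2 * h) else 1.
Proof.
move=> h0; rewrite /box_cdf; case: (lerP u) => uNh.
  by rewrite !tpow1_le0 ?subrr ?mul0r//; lra.
rewrite tpow1_gt0; last by lra.
case: (lerP u) => uh; first by rewrite tpow1_le0 ?subr0//; lra.
by rewrite tpow1_gt0 ?subr_gt0//; field; rewrite gt_eqF.
Qed.

Lemma box_cdf_ge0 h u : 0 < h -> 0 <= box_cdf h u.
Proof.
move=> h0; rewrite box_cdfE//; case: (lerP u) => // uNh;
  case: (lerP u) => // uh.
by apply: divr_ge0; lra.
Qed.

Lemma box_cdf_opp h u : 0 < h -> box_cdf h u + box_cdf h (- u) = 1.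
Proof.
move=> h0; rewrite !box_cdfE// lerN2.
have hN0 : h != 0 by rewrite gt_eqF.
case: (lerP u (- h)) => a; case: (lerP u h) => b; case: (lerP h u) => c;
  case: (lerP (- u) h) => d; try lra.
(* Linear arithmetic leaves the corners [u = - h] and [u = h], where two branches meet, and the
   interior of the ramp. *)
- have -> : u = - h by lra.
  by field.
- have -> : u = h by lra.
  by field.
- by field.
Qed.

Lemma box_cdf_le1 h u : 0 < h -> box_cdf h u <= 1.
Proof.
by move=> h0; rewrite -(box_cdf_opp u h0) lerDl box_cdf_ge0.
Qed.

(** The integral is half the length of [[-1, Num.min 1 (u / h)]], which degenerates when
    [u <= - h]. *)
Lemma unif_kernel_cdfE h u : 0 < h -> unif_kernel_cdf (u / h) = box_cdf h u.
Proof.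
move=> h0; rewrite box_cdfE// /unif_kernel_cdf /antiderivative /Rintegral.
under eq_integral do rewrite /unif_kernel EFinM.
rewrite ge0_integralZl_EFin//; last exact/measurable_EFinP.
rewrite integral_indic//.
rewrite (_ : _ `&` _ = `[-1, Num.min 1 (u / h)]%classic); last first.
  apply/seteqP; split => x /=; rewrite !in_itv/= le_min.
    by move=> [/andP[-> ->] ->].
  by move=> /and3P[-> -> ->].
have := @lebesgue_measure_itv R `[-1, Num.min 1 (u / h)].
rewrite /= => ->; rewrite lte_fin lt_min ltr_pdivlMr// mulN1r.
rewrite (_ : -1 < 1 = true) ?andTb; last by lra.
rewrite (ltNge (- h)); case: (lerP u (- h)) => uNh /=; first by rewrite mulr0.
rewrite /Order.min ltr_pdivlMr// mul1r ltNge; case: (lerP u h) => uh /=.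
  by field; rewrite gt_eqF.
by field.
Qed.

End convolution.

(** * Tonelli's theorem for Lebesgue measure *)

Section tonelli.
Context {R : realType}.
Local Notation mu := (@lebesgue_measure R).

Lemma measurable_has_integral (H : R * R -> R) (A : R -> R) :
  measurable_fun [set: R * R] H -> (forall z, 0 <= H z) ->
  (forall x, has_integral (fun y => H (x, y)) (A x)) ->
  measurable_fun [set: R] A.
Proof.
move=> mH H0 HA; apply/measurable_EFinP.
rewrite (_ : EFin \o A = fun x => (\int[mu]_y (H (x, y))%:E)%E); last first.
  by apply/funext => x; case: (HA x).
apply: (@measurable_fun_fubini_tonelli_F _ _ _ _ _ mu (EFin \o H)) => //.
exact/measurable_EFinP.
Qed.

Lemma tonelli_lebesgue (H : R * R -> R) :
  measurable_fun [set: R * R] H -> (forall z, 0 <= H z) ->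
  (\int[mu]_x \int[mu]_y (H (x, y))%:E = \int[mu]_y \int[mu]_x (H (x, y))%:E)%E.
Proof.
move=> mH H0; apply: (@fubini_tonelli _ _ _ _ _ mu mu (EFin \o H)) => //.
exact/measurable_EFinP.
Qed.

End tonelli.

(** * Integrals of products of two smoothed functions *)

Section correlation.
Context {R : realType}.
Local Notation mu := (@lebesgue_measure R).

(* With [X], [Y] independent of density [f], this is the identity
   [\int E(F1(x - X)) E(F2(Y - x)) dx = E(C(Y - X))]. *)
Lemma has_integral_correlation (f g F1 F2 C A1 A2 : R -> R) v :
  measurable_fun [set: R] f -> (forall x, 0 <= f x) ->
  measurable_fun [set: R] F1 -> (forall x, 0 <= F1 x) ->
  measurable_fun [set: R] F2 -> (forall x, 0 <= F2 x) ->
  measurable_fun [set: R] C -> is_convolution F1 F2 C ->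
  (forall t, has_integral (fun y => f y * f (y + t)) (g t)) ->
  (forall x, has_integral (fun y => F1 (x - y) * f y) (A1 x)) ->
  (forall x, has_integral (fun y => F2 (y - x) * f y) (A2 x)) ->
  has_integral (fun t => C t * g t) v ->
  has_integral (fun x => A1 x * A2 x) v.
Proof.
move=> mf f0 mF1 F10 mF2 F20 mC FC fg FA1 FA2 [_ Cgv].
have mfst : measurable_fun [set: R * R] (fst : R * R -> R)
  by exact: measurable_fst.
have msnd : measurable_fun [set: R * R] (snd : R * R -> R)
  by exact: measurable_snd.
have mA2 : measurable_fun [set: R] A2.
  apply: (@measurable_has_integral R (fun z => F2 (z.2 - z.1) * f z.2)) => //.
  - apply: measurable_funM; apply: measurableT_comp => //.
    exact: measurable_funB.
  - by move=> z; rewrite mulr_ge0.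
have mA1 : measurable_fun [set: R] A1.
  apply: (@measurable_has_integral R (fun z => F1 (z.1 - z.2) * f z.2)) => //.
  - apply: measurable_funM; apply: measurableT_comp => //.
    exact: measurable_funB.
  - by move=> z; rewrite mulr_ge0.
have A10 x : 0 <= A1 x.
  rewrite -(Rintegral_has_integral (FA1 x)); apply: Rintegral_ge0 => y _.
  by rewrite mulr_ge0.
have A20 x : 0 <= A2 x.
  rewrite -(Rintegral_has_integral (FA2 x)); apply: Rintegral_ge0 => y _.
  by rewrite mulr_ge0.
have C0 t : 0 <= C t.
  rewrite -(Rintegral_has_integral (FC t)); apply: Rintegral_ge0 => y _.
  by rewrite mulr_ge0.
apply: ge0_has_integral; first exact: measurable_funM.
  by move=> x; rewrite mulr_ge0.
rewrite -Cgv.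
(* [A1] is expanded first, with [A2 x] kept as a constant, so that the integral over [y] can be
   moved outside. *)
transitivity (\int[mu]_x \int[mu]_y (A2 x * (F1 (x - y) * f y))%:E)%E.
  apply: eq_integral => x _; have [_ ->] := has_integralZ (A2 x) (FA1 x).
  by rewrite mulrC.
rewrite (@tonelli_lebesgue R (fun z => A2 z.1 * (F1 (z.1 - z.2) * f z.2)))/=;
  last 2 first.
- apply: measurable_funM; first exact: measurableT_comp.
  apply: measurable_funM; apply: measurableT_comp => //.
  exact: measurable_funB.
- by move=> z; rewrite !mulr_ge0.
transitivity (\int[mu]_y \int[mu]_t (C t * (f y * f (y + t)))%:E)%E.
  apply: eq_integral => y _.
  (* For fixed [y] the variable of [A2] is written [y + t], so that [t] is the difference of the two
     points. *)
  transitivity (\int[mu]_x \int[mu]_t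
      (F1 (x - y) * f y * (F2 (y + t - x) * f (y + t)))%:E)%E.
    apply: eq_integral => x _.
    have [_] := has_integralZ (F1 (x - y) * f y)
      (has_integral_affine y ltr01 (FA2 x)).
    rewrite invr1 mul1r [A2 x * _]mulrC => <-.
    by apply: eq_integral => t _; rewrite mul1r.
  rewrite (@tonelli_lebesgue R
    (fun z => F1 (z.1 - y) * f y * (F2 (y + z.2 - z.1) * f (y + z.2))))/=;
      last 2 first.
  - have myz : measurable_fun [set: R * R] (fun z : R * R => y + z.2).
      exact: measurable_funD.
    apply: measurable_funM; apply: measurable_funM => //;
      apply: measurableT_comp => //; exact: measurable_funB.
  - by move=> z; rewrite !mulr_ge0.
  apply: eq_integral => t _.
  (* The shift by [y] turns the integral over [x] into the convolution of [F1] and [F2] at [t]. *)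
  have := has_integralZ (f y * f (y + t)) (has_integral_affine (- y) ltr01
    (FC t)).
  move=> [_]; rewrite invr1 mul1r [f y * _ * C t]mulrC => <-.
  apply: eq_integral => x _; congr EFin.
  rewrite mul1r opprD opprK addrA [- y + x]addrC [t + y]addrC; ring.
(* The last exchange makes the correlation of [f] with itself, [g t], the inner integral. *)
rewrite (@tonelli_lebesgue R (fun z => C z.2 * (f z.1 * f (z.1 + z.2))))/=;
  last 2 first.
- apply: measurable_funM; first exact: measurableT_comp.
  apply: measurable_funM; apply: measurableT_comp => //.
  exact: measurable_funD.
- by move=> z; rewrite !mulr_ge0.
by apply: eq_integral => t _; have [_ ->] := has_integralZ (C t) (fg t).
Qed.

End correlation.

(** * Polynomial growth against normal densities, and standardization *)

Section normal.
Context {R : realType}.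
Local Notation mu := (@lebesgue_measure R).
Implicit Types (a s t : R) (F : R -> R).

Lemma has_integral_normal_pdf a s : has_integral (normal_pdf a s) 1.
Proof.
apply: ge0_has_integral.
- exact: measurable_normal_pdf.
- by move=> x; exact: normal_pdf_ge0.
- exact: integral_normal_pdf.
Qed.

(** A polynomial factor is absorbed by doubling the variance, which leaves an integrable
    majorant. *)
Lemma normal_pdf_polyM_le a s k : 0 < s -> exists2 c, 0 <= c &
  forall t, (1 + `|t|) ^+ k * normal_pdf a s t <=
    c * normal_pdf a (s * Num.sqrt 2) t.
Proof.
move=> s0; have s2 : s * Num.sqrt 2 != 0
  by rewrite gt_eqF// mulr_gt0// sqrtr_gt0.
have sN0 : s != 0 by rewrite gt_eqF.
(* The exponent comes from [(1 + |t|)^k <= exp (k * |t|)], [|t| <= |a| + |t - a|] and [k * |t - a|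
   <= (t - a)^2 / (4 * s^2) + (k * s)^2]; the quotient of peaks corrects the normalization. *)
pose c : R := expR (k%:R * `|a| + (k%:R * s) ^+ 2) * normal_peak s /
  normal_peak (s * Num.sqrt 2).
exists c => [|t].
  by rewrite /c divr_ge0 ?normal_peak_ge0// mulr_ge0 ?expR_ge0 ?normal_peak_ge0.
rewrite !normal_pdfE//= /c -[leRHS]mulrA mulKf ?gt_eqF ?normal_peak_gt0//.
rewrite -[leRHS]mulrA [leRHS]mulrCA [leLHS]mulrCA.
rewrite ler_wpM2l ?normal_peak_ge0// /normal_fun -expRD.
have le1 : (1 + `|t|) ^+ k <= expR (k%:R * `|t|).
  by rewrite expRM_natl lerXn2r ?nnegrE ?expR_ge0 ?expR_ge1Dx// addr_ge0.
apply: (le_trans (ler_wpM2r (expR_ge0 _) le1)).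
rewrite -expRD ler_expR [(s * _) ^+ 2]exprMn sqr_sqrtr//.
have tri : `|t| <= `|a| + `|t - a|.
  by rewrite -{1}(subrK a t) addrC ler_normD.
have : k%:R * `|t| <= k%:R * `|a| + k%:R * `|t - a|.
  by rewrite -mulrDr ler_wpM2l.
have : 0 <= (`|t - a| / (2 * s) - k%:R * s) ^+ 2 by exact: sqr_ge0.
rewrite sqrrB expr_div_n real_normK ?num_real// => H1 H2.
set v := `|t - a| in H1 H2 *; set w := (t - a) ^+ 2 in H1 *.
have E1 : w / (2 * s) ^+ 2 = w / s ^+ 2 / 4 by field.
have E2 : - w / (s ^+ 2 *+ 2) = - (w / s ^+ 2 / 2) by rewrite -mulr_natr; field.
have E3 : - w / (s ^+ 2 * 2 *+ 2) = - (w / s ^+ 2 / 4) by rewrite -mulr_natr;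
  field.
have E4 : v / (2 * s) * (k%:R * s) *+ 2 = k%:R * v by rewrite -mulr_natr; field.
by rewrite E1 E4 in H1; rewrite E2 E3; lra.
Qed.

Lemma integrable_normal_pdf_poly a s k c F : 0 < s ->
  measurable_fun [set: R] F ->
  (forall t, `|F t| <= c * (1 + `|t|) ^+ k) ->
  mu.-integrable [set: R] (EFin \o (fun t => F t * normal_pdf a s t)).
Proof.
move=> s0 mF Fc; have [c' c'0 le] := normal_pdf_polyM_le a k s0.
have [iN _] := has_integralZ (`|c| * c') (has_integral_normal_pdf a (s *
  Num.sqrt 2)).
apply: le_integrable iN => //.
  by apply/measurable_EFinP/measurable_funM => //; exact: measurable_normal_pdf.
move=> t _; rewrite lee_fin normrM (ger0_norm (normal_pdf_ge0 _ _ _)).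
rewrite (ger0_norm (mulr_ge0 (mulr_ge0 _ _) (normal_pdf_ge0 _ _ _)))//.
apply: (@le_trans _ _ (`|c| * (1 + `|t|) ^+ k * normal_pdf a s t)).
  rewrite ler_wpM2r ?normal_pdf_ge0//; apply: (le_trans (Fc t)).
  by rewrite ler_wpM2r ?exprn_ge0 ?addr_ge0// ler_norm.
by rewrite -!mulrA ler_wpM2l.
Qed.

Lemma normal_phiE a s t : 0 < s ->
  normal_phi t = s * normal_pdf a s (a + s * t).
Proof.
move=> s0; rewrite /normal_phi !normal_pdfE ?oner_eq0 ?gt_eqF// /normal_fun mulrA.
congr (_ * expR _); last first.
  by rewrite subr0 addrAC subrr add0r expr1n exprMn; field; rewrite gt_eqF.
rewrite /normal_peak expr1n mul1r -[s ^+ 2 * _ *+ _]mulrnAr sqrtrM ?sqr_ge0//.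
rewrite sqrtr_sqr gtr0_norm// invfM mulVKf// gt_eqF//.
Qed.

Lemma normal_phi_opp t : normal_phi (- t) = normal_phi t.
Proof.
by rewrite /normal_phi !normal_pdfE ?oner_eq0// /normal_fun !subr0 sqrrN.
Qed.

Lemma has_integral_normal_std a s F v : 0 < s ->
  has_integral (fun t => F t * normal_pdf a s t) v ->
  has_integral (fun z => F (a + s * z) * normal_phi z) v.
Proof.
move=> s0 Fv; have := has_integralZ s (has_integral_affine a s0 Fv).
apply: has_integral_eq => [z|]; last by rewrite mulVKf// gt_eqF.
by rewrite (normal_phiE a z s0) mulrCA.
Qed.

End normal.

(** * Truncated moments of the normal law as iterated antiderivatives *)

Section normal_antiderivatives.
Context {R : realType}.
Local Notation mu := (@lebesgue_measure R).
Implicit Types (a b s t x : R).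

(* Completing the square in [y]. *)
Lemma normal_pdf_prod a b s1 s2 y t : 0 < s1 -> 0 < s2 ->
  normal_pdf a s1 y * normal_pdf b s2 (y + t) =
  normal_pdf ((a * s2 ^+ 2 + (b - t) * s1 ^+ 2) / (s1 ^+ 2 + s2 ^+ 2))
             (s1 * s2 / Num.sqrt (s1 ^+ 2 + s2 ^+ 2)) y *
  normal_pdf (b - a) (Num.sqrt (s1 ^+ 2 + s2 ^+ 2)) t.
Proof.
move=> s10 s20; set q := s1 ^+ 2 + s2 ^+ 2.
have q0 : 0 < q by rewrite addr_gt0// exprn_gt0.
have sq0 : 0 < Num.sqrt q by rewrite sqrtr_gt0.
have sN1 : s1 != 0 by rewrite gt_eqF.
have sN2 : s2 != 0 by rewrite gt_eqF.
have qN0 : q != 0 by rewrite gt_eqF.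
have sqN0 : Num.sqrt q != 0 by rewrite gt_eqF.
rewrite !normal_pdfE ?mulf_neq0 ?invr_eq0//=.
rewrite mulrACA [RHS]mulrACA; congr (_ * _).
  rewrite /normal_peak -!invfM -!sqrtrM;
    do ?by rewrite pmulrn_lge0// mulr_ge0 ?sqr_ge0 ?pi_ge0.
  rewrite expr_div_n exprMn sqr_sqrtr ?ltW//; congr (Num.sqrt _)^-1.
  by field.
rewrite /normal_fun -!expRD; congr expR.
rewrite expr_div_n exprMn sqr_sqrtr ?ltW//.
have qNE : s1 ^+ 2 + s2 ^+ 2 != 0 by [].
by rewrite /q; field; rewrite sN1 sN2 qNE.
Qed.

(** In the factorization of [normal_pdf_prod] only the first factor depends on [y], and it is a
    density. *)
Lemma has_integral_normal_pdf_correlation a b s1 s2 t : 0 < s1 -> 0 < s2 ->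
  has_integral (fun y => normal_pdf a s1 y * normal_pdf b s2 (y + t))
    (normal_pdf (b - a) (Num.sqrt (s1 ^+ 2 + s2 ^+ 2)) t).
Proof.
move=> s10 s20.
have := has_integralZ (normal_pdf (b - a) (Num.sqrt (s1 ^+ 2 + s2 ^+ 2)) t)
  (has_integral_normal_pdf
     ((a * s2 ^+ 2 + (b - t) * s1 ^+ 2) / (s1 ^+ 2 + s2 ^+ 2))
             (s1 * s2 / Num.sqrt (s1 ^+ 2 + s2 ^+ 2))).
by apply: has_integral_eq => [y|]; rewrite ?mulr1// normal_pdf_prod// mulrC.
Qed.

Lemma tpow_bound k a e t : `|e| = 1 ->
  `|tpow k (a + e * t)| <= (1 + `|a|) ^+ k * (1 + `|t|) ^+ k.
Proof.
move=> e1; rewrite ger0_norm ?tpow_ge0// (le_trans (tpow_le _ _))// -exprMn.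
rewrite lerXn2r ?nnegrE ?mulr_ge0 ?addr_ge0// (le_trans (ler_normD _ _))//.
rewrite normrM e1 mul1r mulrDl mul1r mulrDr mulr1.
have := mulr_ge0 (normr_ge0 a) (normr_ge0 t); lra.
Qed.

Lemma integrable_tpow_normal k x a s : 0 < s ->
  mu.-integrable [set: R]
    (EFin \o (fun t => tpow k (x - t) * normal_pdf a s t)).
Proof.
move=> s0; apply: (@integrable_normal_pdf_poly R _ _ k ((1 + `|x|) ^+ k)) => //.
  by apply: measurableT_comp;
    [exact: measurable_tpow|exact: measurable_funB].
move=> t; have := @tpow_bound k x (-1) t; rewrite mulN1r; apply.
by rewrite normrN1.
Qed.

(** For a nonnegative [H], finiteness of one iterated integral carries over to the other, so
    integrability of [A] is obtained along with its integral. *)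
Lemma tonelli_has_integral (H : R * R -> R) (A B : R -> R) v :
  measurable_fun [set: R * R] H -> (forall z, 0 <= H z) ->
  (forall x, has_integral (fun y => H (x, y)) (A x)) ->
  (forall y, has_integral (fun x => H (x, y)) (B y)) ->
  has_integral B v -> has_integral A v.
Proof.
move=> mH H0 HA HB [_ Bv]; apply: ge0_has_integral.
- exact: measurable_has_integral HA.
- by move=> x; rewrite -(Rintegral_has_integral (HA x)); exact: Rintegral_ge0.
- transitivity (\int[mu]_x \int[mu]_y (H (x, y))%:E)%E.
    by apply: eq_integral => x _; case: (HA x).
  rewrite tonelli_lebesgue//; transitivity (\int[mu]_x (B x)%:E)%E => //.
  by apply: eq_integral => y _; case: (HB y).
Qed.

(** Since [tpow 0] equals 1 at 0, [tpow 0 (x - t)] is the indicator of the closed half-line []-oo,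
    x]]. *)
Lemma antiderivativeE (F : R -> R) x v :
  has_integral (fun t => tpow 0 (x - t) * F t) v -> antiderivative F x = v.
Proof.
move=> /Rintegral_has_integral <-; rewrite /antiderivative Rintegral_mkcond.
apply: eq_Rintegral => t _; rewrite patchE /tpow mem_setE in_itv/= subr_ge0.
by case: ifP; rewrite ?mul1r ?mul0r.
Qed.

(** Cauchy's formula for repeated integration, by induction on [k]: after an exchange of integrals,
    the kernel [tpow k (s - t)] integrated over [s <= x] gives [tpow k.+1 (x - t) / k.+1]. *)
Lemma has_integral_normal_phi_iter k x :
  has_integral (fun t => tpow k (x - t) * normal_phi t)
    (k`!%:R * normal_phi_iter (Negz k) x).
Proof.
have iphi j z : mu.-integrable [set: R]
    (EFin \o (fun t => tpow j (z - t) * normal_phi t)).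
  exact: integrable_tpow_normal.
elim: k x => [|k ih] x.
  rewrite mul1r /=; have H := integrable_has_integral (iphi 0%N x).
  by rewrite (antiderivativeE H).
have k0 : k`!%:R != 0 :> R by rewrite pnatr_eq0 -lt0n fact_gt0.
pose v := \int[mu]_t (tpow k.+1 (x - t) * normal_phi t).
have vE : has_integral (fun t => tpow k.+1 (x - t) * normal_phi t) v.
  exact: integrable_has_integral (iphi k.+1 x).
have step : has_integral
    (fun s => tpow 0 (x - s) * (k`!%:R * normal_phi_iter (Negz k) s))
    (k.+1%:R^-1 * v).
  apply: (@tonelli_has_integral
    (fun z => tpow 0 (x - z.1) * (tpow k (z.1 - z.2) * normal_phi z.2)) _
    (fun t => k.+1%:R^-1 * (tpow k.+1 (x - t) * normal_phi t))).
  - apply: measurable_funM.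
      by apply: measurableT_comp;
        [exact: measurable_tpow|exact: measurable_funB].
    apply: measurable_funM; last first.
      by apply: measurableT_comp => //; exact: measurable_normal_pdf.
    by apply: measurableT_comp;
      [exact: measurable_tpow|exact: measurable_funB].
  - by move=> z; rewrite !mulr_ge0 ?tpow_ge0// normal_pdf_ge0.
  - by move=> s; exact: (has_integralZ (tpow 0 (x - s)) (ih s)).
  (* Shifted by [t], the integral over [s] is the convolution of [tpow k] with [tpow 0] at
     [x - t]. *)
  - move=> t; have := has_integralZ (normal_phi t)
      (has_integral_affine (- t) ltr01 (has_integral_tpow_tpow0 k (x - t))).
    apply: has_integral_eq => [s|].
      rewrite mul1r opprD opprK addrA subrK [- t + s]addrC /=; ring.
    by rewrite invr1 mul1r mulrCA mulrA [LHS]mulrC.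
  - exact: has_integralZ.
have {}step := has_integralZ k`!%:R^-1 step.
have E : normal_phi_iter (Negz k.+1) x = k`!%:R^-1 * (k.+1%:R^-1 * v).
  rewrite [LHS]/=; apply: antiderivativeE; apply: has_integral_eq step => // s.
  by rewrite mulrCA mulKf.
apply: has_integral_eq vE => //.
by rewrite E factS natrM -mulrA !mulVKf ?k0 ?pnatr_eq0.
Qed.

End normal_antiderivatives.

(** * Half-line integrals and the second moment of the standard normal law *)

Section half_lines.
Context {R : realType}.
Local Notation mu := (@lebesgue_measure R).

(** Both closed half-lines contain [x], so the indicators overlap there. The difference of integrals
    belongs to the open half-line []x, +oo[], and adding one point does not change it. *)
Lemma has_integral_tpow0_compl (f : R -> R) (x a b : R) :
  has_integral f b -> has_integral (fun y => tpow 0 (x - y) * f y) a ->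
  has_integral (fun y => tpow 0 (y - x) * f y) (b - a).
Proof.
move=> fb fa; have [H Hi] := has_integralB fb fa.
have mf := has_integral_measurable fb.
have E1 : (fun y => tpow 0 (y - x) * f y) = f \_ `[x, +oo[.
  apply/funext => y; rewrite patchE mem_setE in_itv/= andbT /tpow subr_ge0.
  by case: ifP; rewrite ?mul1r ?mul0r.
have E2 : (fun y => f y - tpow 0 (x - y) * f y) = f \_ `]x, +oo[.
  apply/funext => y; rewrite patchE mem_setE in_itv/= andbT /tpow subr_ge0.
  by case: ltP => _; rewrite ?mul1r ?mul0r ?subr0 ?subrr.
have mi : measurable_fun `]x, +oo[ (EFin \o f).
  by apply: measurable_funTS; exact/measurable_EFinP.
rewrite E2 in H Hi; rewrite E1; split.
  have /integrableP[_ fi] : mu.-integrable [set: R] (EFin \o f) by case: fb.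
  rewrite -restrict_EFin; apply/integrable_restrict => //; rewrite setTI.
  by case: fb => fi' _; exact: integrableS fi'.
have RE (D : set R) : (\int[mu]_z ((f \_ D) z)%:E =
  \int[mu]_(z in D) (f z)%:E)%E.
  rewrite [RHS]integral_mkcond.
  by under [RHS]eq_integral do rewrite restrict_EFin.
rewrite RE -Hi; have <- : (\int[mu]_(z in `]x, +oo[) (f z)%:E =
    \int[mu]_z (f z - tpow 0 (x - z) * f z)%:E)%E by rewrite -RE -E2.
apply/esym; exact: (@integral_itv_obnd_cbnd R x +oo%O (EFin \o f) mi).
Qed.

(** The integrals over the two half-lines are equal by symmetry of [normal_phi] and add up to 1. *)
Lemma has_integral_half_normal :
  has_integral (fun z : R => tpow 0 z * normal_phi z) 2^-1.
Proof.
have iphi : has_integral (@normal_phi R) 1 by exact: has_integral_normal_pdf.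
have h : has_integral (fun z : R => tpow 0 (0 - z) * normal_phi z) _ :=
  integrable_has_integral (@integrable_tpow_normal R 0 0 0 1 ltr01).
set v := (X in has_integral _ X) in h.
have h1 := has_integral_tpow0_compl iphi h.
have E : v = 1 - v.
  apply: (has_integral_uniq (has_integral_opp h)).
  by apply: has_integral_eq h1 => // z;
    rewrite sub0r opprK subr0 normal_phi_opp.
have -> : 2^-1 = 1 - v by lra.
by apply: has_integral_eq h1 => // z; rewrite subr0.
Qed.

(** [- normal_phi] is an antiderivative of the integrand and vanishes at infinity. *)
Lemma integral_normal_tail (t : R) : 0 <= t ->
  (\int[mu]_(z in `[t, +oo[) (z * normal_phi z)%:E = (normal_phi t)%:E)%E.
Proof.
move=> t0.
have phiE z : normal_phi z = normal_peak 1 * expR (- (z ^+ 2 / 2)) :> R.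
  rewrite /normal_phi normal_pdfE ?oner_eq0//= /normal_fun.
  by congr (_ * expR _); field.
have dphi (z : R) : is_derive z 1 (fun z => - normal_phi z) (z * normal_phi z).
  have FE : (fun z : R => - normal_phi z) =
      (fun z : R => - normal_peak 1 * expR (- (z ^+ 2 / 2))) :> (R -> R).
    by apply/funext => y; rewrite phiE mulNr.
  by rewrite FE; apply: is_derive_eq; rewrite phiE /GRing.scale/=; field.
rewrite (@ge0_continuous_FTC2y _ _ (fun z => - normal_phi z) _ 0).
- by rewrite sub0e EFinN oppeK.
- by move=> x tx; rewrite mulr_ge0 ?normal_pdf_ge0// (le_trans t0).
- apply: continuous_subspaceT => x; apply: cvgM; first exact: cvg_id.
  by apply: continuous_normal_pdf; rewrite oner_eq0.
- rewrite -oppr0; apply: cvgN; have -> := funext phiE.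
  rewrite -(mulr0 (normal_peak 1)); apply: cvgM; first exact: cvg_cst.
  apply: (@cvg_comp _ _ _ (fun z : R => z ^+ 2 / 2) (fun z => expR (- z))).
    by apply/gt0_cvgMly => //; exact: cvgr_expr2.
  exact: cvgr_expR.
- by move=> x _; case: (dphi x).
- apply: cvg_at_right_filter; apply: cvgN.
  by apply: continuous_normal_pdf; rewrite oner_eq0.
- by move=> x _; rewrite derive1E; apply: derive_val.
Qed.

(** On the positive half-line one factor [z] is written as the length of [[0, z]] and the integrals
    are exchanged: the inner one becomes a tail of [z * normal_phi z], which is [normal_phi], and
    the outer one gives 1/2. Reflection supplies the other half. *)
Lemma has_integral_normal_sqr : has_integral (fun z : R =>
  z ^+ 2 * normal_phi z) 1.
Proof.
have h : has_integral (fun z : R => tpow 2 z * normal_phi z) 2^-1.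
  have i2 : has_integral (fun z : R => tpow 2 (0 - z) * normal_phi z) _ :=
    integrable_has_integral (@integrable_tpow_normal R 2 0 0 1 ltr01).
  have {}i2 := has_integral_opp i2.
  set v := (X in has_integral _ X) in i2.
  have {}i2 : has_integral (fun z : R => tpow 2 z * normal_phi z) v.
    by apply: has_integral_eq i2 => // z; rewrite sub0r opprK normal_phi_opp.
  have := @tonelli_has_integral R
    (fun z => tpow 0 z.1 * (tpow 0 (z.2 - z.1) * (tpow 1 z.2 * normal_phi z.2)))
    (fun t => tpow 0 t * normal_phi t) (fun z => tpow 2 z * normal_phi z) v.
  move=> /(_ _ _ _ _ i2) H; suff -> : 2^-1 = v by [].
  apply: has_integral_uniq has_integral_half_normal (H _ _ _ _).
  - apply: measurable_funM; first exact: measurableT_comp (measurable_tpow 0) _.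
    apply: measurable_funM.
      by apply: measurableT_comp;
        [exact: measurable_tpow|exact: measurable_funB].
    apply: measurable_funM; first exact: measurableT_comp (measurable_tpow 1) _.
    by apply: measurableT_comp => //; exact: measurable_normal_pdf.
  - by move=> z; rewrite !mulr_ge0 ?tpow_ge0// normal_pdf_ge0.
  - move=> t /=; have [t0|t0] := leP 0 t; last first.
      (* For [t < 0] both sides vanish; the known integral [i2] multiplied by 0 serves as the
         integral of the zero function. *)
      have := has_integralZ 0 i2.
      by apply: has_integral_eq => [z|]; rewrite /tpow (leNgt 0 t) t0 !mul0r.
    apply: has_integralZ; apply: ge0_has_integral.
    + apply: measurable_funM.
        by apply: measurableT_comp;
          [exact: measurable_tpow|exact: measurable_funB].
      apply: measurable_funM; first exact: measurable_tpow.
      exact: measurable_normal_pdf.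
    + by move=> z; rewrite !mulr_ge0 ?tpow_ge0// normal_pdf_ge0.
    + rewrite -integral_normal_tail// [RHS]integral_mkcond.
      apply: eq_integral => z _; rewrite patchE mem_setE in_itv/= andbT.
      rewrite /tpow subr_ge0; case: ifPn => tz; last by rewrite mul0r.
      by rewrite mul1r (le_trans t0 tz).
  - move=> z /=; have := has_integralZ (tpow 1 z *
    normal_phi z) (tpow0_tpow0 z).
    apply: has_integral_eq => [x|]; first by ring.
    by rewrite mulrAC /tpow; case: ifP => _; rewrite ?mul0r// expr1 -expr2.
have := has_integralD h (has_integral_opp h).
apply: has_integral_eq => [z|]; last by field.
by rewrite (tpow_opp 1 z) normal_phi_opp -mulrDl expr2 mulrNN !mul1r.
Qed.

End half_lines.

(** * Moments of general normal laws *)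

Section normal_moments.
Context {R : realType}.
Local Notation mu := (@lebesgue_measure R).
Implicit Types (a s x : R).

Lemma has_integral_odd (F : R -> R) v : (forall x, F (- x) = - F x) ->
  has_integral F v -> v = 0.
Proof.
move=> oF Fv.
have : v = -1 * v.
  apply: has_integral_uniq (has_integralZ (-1) Fv).
  by apply: has_integral_eq (has_integral_opp Fv) => // x; rewrite oF mulN1r.
by lra.
Qed.

Lemma integrable_expr_normal k a s : 0 < s ->
  mu.-integrable [set: R] (EFin \o (fun t => t ^+ k * normal_pdf a s t)).
Proof.
move=> s0; apply: (@integrable_normal_pdf_poly R a s k 1 (fun t => t ^+ k)) =>
  //.
by move=> t; rewrite mul1r normrX lerXn2r ?nnegrE ?addr_ge0// lerDr.
Qed.

(** After standardization, [(a + s * z)^2] is expanded against the moments 1, 0, 1 of the standard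
    normal law. *)
Lemma has_integral_normal_pdf_sqr a s : 0 < s ->
  has_integral (fun t => t ^+ 2 * normal_pdf a s t) (a ^+ 2 + s ^+ 2).
Proof.
move=> s0; have H := integrable_has_integral (integrable_expr_normal 2 a s0).
suff -> : a ^+ 2 + s ^+ 2 = \int[mu]_t (t ^+ 2 * normal_pdf a s t) by [].
have i0 : has_integral (@normal_phi R) 1 by exact: has_integral_normal_pdf.
have i1 : has_integral (fun z : R => z * normal_phi z) 0.
  have h : has_integral (fun z : R => z ^+ 1 * normal_phi z) _ :=
    integrable_has_integral (integrable_expr_normal 1 0 (@ltr01 R)).
  rewrite -(has_integral_odd _ h) => [|z]; last first.
    by rewrite expr1 normal_phi_opp mulNr.
  by apply: has_integral_eq h.
apply: has_integral_uniq (has_integral_normal_std s0 H).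
have := has_integralD (has_integralD (has_integralZ (a ^+ 2) i0)
  (has_integralZ (2 * a * s) i1)) (has_integralZ (s ^+ 2)
    (@has_integral_normal_sqr R)).
by apply: has_integral_eq => [z|]; ring.
Qed.

Lemma has_integral_tpow_normal_pdf k x a (v : R) : 0 < v ->
  has_integral (fun t => tpow k (x - t) * normal_pdf a (Num.sqrt v) t)
    (k`!%:R * normal_phi_iter_scaled (Negz k) x a v).
Proof.
move=> v0; have s0 : 0 < Num.sqrt v by rewrite sqrtr_gt0.
have H := integrable_has_integral (integrable_tpow_normal k x a s0).
apply: has_integral_eq (H) => //.
apply: has_integral_uniq (has_integral_normal_std s0 H) _.
rewrite /normal_phi_iter_scaled; set s := Num.sqrt v in s0 *.
(* [Negz k] is [-(k + 1)], so the exponent [p + 1] of the scaling is [-k]; dividing by it matches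
   the factor [s^k] taken out of the truncated power of [s * ((x - a) / s - z)]. *)
have sE : s ^ (Negz k + 1) = s ^- k.
  by rewrite NegzE -addn1 PoszD opprD addrNK exprnN.
rewrite sE invrK mulrA mulrC.
have := has_integralZ (s ^+ k) (has_integral_normal_phi_iter k ((x - a) / s)).
apply: has_integral_eq => // z; rewrite mulrA; congr (_ * _).
rewrite /tpow opprD addrA.
have -> : (x - a) / s - z = (x - a - s * z) / s by field; rewrite gt_eqF.
rewrite pmulr_lge0 ?invr_gt0//; case: ifP => _; last by rewrite mulr0.
by rewrite -exprMn mulrC divfK// gt_eqF.
Qed.

End normal_moments.

(** * The mixture density and the law of the difference [Y - X] *)

Section mixture.
Context {R : realType} (m : nat) (w c sigma : 'I_m -> R).
Hypothesis sigma_gt0 : forall j, 0 < sigma j.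
Hypothesis w_gt0 : forall j, 0 < w j.
Hypothesis w_sum1 : \sum_(j < m) w j = 1.
Local Notation mu := (@lebesgue_measure R).
Local Notation f := (mixture_pdf w c sigma).

Lemma mixture_pdfE x :
  f x = \sum_(j < m) w j * normal_pdf (c j) (sigma j) x.
Proof.
apply: eq_bigr => j _; congr (_ * _).
have sN0 : sigma j != 0 by rewrite gt_eqF.
rewrite (@normal_phiE R (c j) (sigma j))// mulKf//; congr normal_pdf.
by rewrite mulrC divfK// addrC subrK.
Qed.

Lemma mixture_pdf_ge0 x : 0 <= f x.
Proof.
by rewrite mixture_pdfE sumr_ge0// => j _;
  rewrite mulr_ge0 ?normal_pdf_ge0 ?ltW.
Qed.

Lemma has_integral_mixture_pdf : has_integral f 1.
Proof.
have := has_integral_sum (index_enum 'I_m)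
  (fun j => has_integralZ (w j) (has_integral_normal_pdf (c j) (sigma j))).
apply: has_integral_eq => [x|]; first by rewrite mixture_pdfE.
by rewrite -[RHS]w_sum1; apply: eq_bigr => j _; rewrite mulr1.
Qed.

Lemma measurable_mixture_pdf : measurable_fun [set: R] f.
Proof. exact: has_integral_measurable has_integral_mixture_pdf. Qed.

(* The density of the difference of two independent variables of density [f]. *)
Definition mixture_diff_pdf (t : R) : R := \sum_(i < m) \sum_(j < m)
  w i * w j * normal_pdf (c i - c j) (Num.sqrt (sigma i ^+ 2 + sigma j ^+ 2)) t.
Local Notation g := mixture_diff_pdf.

Lemma mixture_pdf_correlation t : has_integral (fun y => f y * f (y + t)) (g t).
Proof.
(* The factor [f y] carries the index [j] and [f (y + t)] the index [i], which gives the location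
   [c i - c j] used in [mixture_J]. *)
have := has_integral_sum (index_enum 'I_m) (fun i =>
  has_integral_sum (index_enum 'I_m) (fun j =>
   has_integralZ (w i * w j) (has_integral_normal_pdf_correlation (c j) (c i) t
     (sigma_gt0 j) (sigma_gt0 i)))).
apply: has_integral_eq => [y|]; last first.
  by apply: eq_bigr => i _; apply: eq_bigr => j _;
    rewrite [sigma j ^+ 2 + _]addrC.
rewrite !mixture_pdfE mulrC mulr_suml; apply: eq_bigr => i _.
by rewrite mulr_sumr; apply: eq_bigr => j _; ring.
Qed.

(** Exchanging the indices [i] and [j] negates the location and keeps the variance. *)
Lemma mixture_diff_pdf_opp t : g (- t) = g t.
Proof.
rewrite /g exchange_big/=; apply: eq_bigr => i _; apply: eq_bigr => j _.
have s0 : Num.sqrt (sigma j ^+ 2 + sigma i ^+ 2) != 0.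
  by rewrite gt_eqF// sqrtr_gt0 addr_gt0// exprn_gt0.
rewrite [sigma i ^+ 2 + _]addrC !normal_pdfE// /normal_fun.
congr (_ * (_ * expR (- _ / _))); first by rewrite mulrC.
by rewrite -sqrrN; congr (_ ^+ 2); ring.
Qed.

Lemma has_integral_mixture_diff (F : R -> R) (v : 'I_m -> 'I_m -> R) :
  (forall i j, has_integral (fun t => F t *
     normal_pdf (c i - c j) (Num.sqrt (sigma i ^+ 2 + sigma j ^+ 2)) t)
       (v i j)) ->
  has_integral (fun t => F t * g t) (\sum_(i < m) \sum_(j < m) w i * w j *
    v i j).
Proof.
move=> Fv; have := has_integral_sum (index_enum 'I_m) (fun i =>
  has_integral_sum (index_enum 'I_m) (fun j =>
    has_integralZ (w i * w j) (Fv i j))).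
apply: has_integral_eq => // t; rewrite /g mulr_sumr; apply: eq_bigr => i _.
by rewrite mulr_sumr; apply: eq_bigr => j _; rewrite mulrCA.
Qed.

Let var_gt0 i j : 0 < sigma i ^+ 2 + sigma j ^+ 2.
Proof. by rewrite addr_gt0// exprn_gt0. Qed.

Lemma has_integral_mixture_J k x :
  has_integral (fun t => tpow k (x - t) * g t)
    (k`!%:R * mixture_J w c sigma x (Negz k)).
Proof.
have := has_integral_mixture_diff (fun i j =>
  has_integral_tpow_normal_pdf k x (c i - c j) (var_gt0 i j)).
apply: has_integral_eq => //; rewrite /mixture_J mulr_sumr;
  apply: eq_bigr => i _.
by rewrite mulr_sumr; apply: eq_bigr => j _; rewrite mulrCA.
Qed.

Lemma has_integral_mixture_J_opp k x :
  has_integral (fun t => tpow k (t + x) * g t)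
    (k`!%:R * mixture_J w c sigma x (Negz k)).
Proof.
apply: has_integral_eq (has_integral_opp (has_integral_mixture_J k x)) => // t.
by rewrite opprK addrC mixture_diff_pdf_opp.
Qed.

Let sum_ww (F : 'I_m -> R) :
  \sum_(i < m) \sum_(j < m) w i * w j * F i = \sum_(i < m) w i * F i.
Proof.
apply: eq_bigr => i _; rewrite -mulr_suml -mulr_sumr w_sum1 mulr1//.
Qed.

Lemma has_integral_mixture_diff_pdf : has_integral g 1.
Proof.
have := has_integral_mixture_diff (F := cst 1) (v := fun _ _ => 1).
move=> H; apply: has_integral_eq (H _) => [t||i j]; first by rewrite mul1r.
  by rewrite (sum_ww (fun _ => 1)) -[RHS]w_sum1; apply: eq_bigr => i _;
    rewrite mulr1.
apply: has_integral_eq (has_integral_normal_pdf _ _) => // t.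
by rewrite mul1r.
Qed.

(** [Y - X] has mean 0 and, by independence, twice the variance of one variable. *)
Lemma has_integral_mixture_diff_sqr :
  has_integral (fun t => t ^+ 2 * g t) (2 * mixture_var w c sigma).
Proof.
have s0 i j : 0 < Num.sqrt (sigma i ^+ 2 + sigma j ^+ 2) by rewrite sqrtr_gt0.
have := has_integral_mixture_diff
  (fun i j => has_integral_normal_pdf_sqr (c i - c j) (s0 i j)).
apply: has_integral_eq => //.
(* Each component has second moment [A i + A j - 2 * c i * c j]. The double sums of [A] collapse
   because the weights add up to 1, and the cross term gives [2 * S^2]. *)
pose A i := c i ^+ 2 + sigma i ^+ 2; pose S := \sum_i w i * c i.
transitivity (\sum_(i < m) \sum_(j < m) (w i * w j * A i + w j * w i * A j -
    2 * (w i * c i) * (w j * c j))).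
  apply: eq_bigr => i _; apply: eq_bigr => j _.
  by rewrite sqr_sqrtr ?(ltW (var_gt0 i j))// /A; ring.
rewrite /mixture_var -/S.
under eq_bigr do rewrite big_split big_split/= sumrN -mulr_sumr.
rewrite !big_split/= sumrN -mulr_suml -mulr_sumr sum_ww.
rewrite [X in _ + X - _]exchange_big/= sum_ww -/S; ring.
Qed.

Lemma mixture_diff_odd k v : odd k ->
  has_integral (fun t => t ^+ k * g t) v -> v = 0.
Proof.
move=> ok; apply: has_integral_odd => t.
by rewrite mixture_diff_pdf_opp exprNn -signr_odd ok mulN1r mulNr.
Qed.

End mixture.

(** * Expectations of bounded functions computed from a density *)

Lemma bounded_integrable d (T : measurableType d) (R : realType)
    (P : probability T R) (F : T -> R) (M : R) :
  measurable_fun [set: T] F -> (forall t, `|F t| <= M) ->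
  P.-integrable [set: T] (EFin \o F).
Proof.
move=> mF FM; apply: measurable_bounded_integrable => //.
  by apply: (le_lt_trans (probability_le1 P measurableT)); rewrite ltry.
exists M; split; first exact: num_real.
by move=> x Mx y _ /=; exact: le_trans (FM y) (ltW Mx).
Qed.

Section density.
Context (R : realType).
Local Notation mu := (@lebesgue_measure R).

(** The Radon-Nikodym derivative of [nu] has the same integral as [f] over every measurable set,
    hence equals [f] almost everywhere and can be replaced by it. *)
Lemma integral_density (nu : probability (measurableTypeR R) R)
    (f G : R -> R) (M a : R) :
  measurable_fun [set: R] f ->
  (forall A, measurable A -> nu A = (\int[mu]_(x in A) (f x)%:E)%E) ->
  measurable_fun [set: R] G -> (forall x, `|G x| <= M) ->
  has_integral (fun y => G y * f y) a ->
  (\int[nu]_y (G y)%:E = a%:E)%E.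
Proof.
move=> mf nuf mG GM [_ Ga].
have mf' : measurable_fun [set: R] (EFin \o f) by exact/measurable_EFinP.
have numu : nu `<< mu.
  apply/null_content_dominatesP => A mA muA0; rewrite nuf//.
  by apply: null_set_integral => //; exact: measurable_funTS.
have iG : nu.-integrable [set: R] (EFin \o G).
  exact: (@bounded_integrable _ _ _ nu G M).
apply: etrans (esym (Radon_Nikodym_change_of_variables numu measurableT iG)) _.
rewrite -Ga; apply: ae_eq_integral => //.
- apply: emeasurable_funM; first exact/measurable_EFinP.
  exact: measurable_int (Radon_Nikodym_integrable _).
- exact/measurable_EFinP/measurable_funM.
- rewrite (_ : (fun x => (G x * f x)%:E) = (fun x => (G x)%:E * (f x)%:E)%E)//.
  apply: ae_eqe_mul2l; apply: integral_ae_eq => //.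
    exact: Radon_Nikodym_integrable.
  by move=> E _ mE; rewrite -Radon_Nikodym_integral// -nuf.
Qed.

Lemma integral_has_density d (T : measurableType d) (P : probability T R)
    (X : {RV P >-> R}) (f G : R -> R) (M a : R) :
  measurable_fun [set: R] f -> has_density X f ->
  measurable_fun [set: R] G -> (forall x, `|G x| <= M) ->
  has_integral (fun y => G y * f y) a ->
  (\int[P]_t (G (X t))%:E = a%:E)%E.
Proof.
move=> mf Xf mG GM Ga.
have mX : measurable_fun [set: T] (X : T -> measurableTypeR R).
  exact: (@measurable_funPT _ _ _ _ X).
(* [Y] is [X] with its codomain retyped as [measurableTypeR R], so that its law has the type
   expected by [integral_density]. *)
pose Y : {mfun T >-> measurableTypeR R} :=
  HB.pack (X : T -> R) (isMeasurableFun.Build _ _ _ _ _ mX).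
have <- : (\int[distribution P Y]_y (G y)%:E = a%:E)%E.
  by apply: (@integral_density _ f G M) => // A mA; exact: Xf.
apply/esym; apply: (@integral_distribution _ _ _ _ _ P Y (EFin \o G)).
  exact/measurable_EFinP.
apply: (@bounded_integrable _ _ _ P (G \o X) M) => [|t]; last exact: GM.
exact: measurableT_comp.
Qed.

End density.

(** * Factorization of expectations under independence *)

Section independence.
Context d (T : measurableType d) (R : realType) (P : probability T R).

Lemma independent_pair (I : finType) (X : I -> {RV P >-> R}) i j (A B : set R) :
  mutually_independent X -> i != j -> measurable A -> measurable B ->
  P (X i @^-1` A `&` X j @^-1` B) = (P (X i @^-1` A) * P (X j @^-1` B))%E.
Proof.
move=> Xind ij mA mB.
pose S k := if k == i then A else B.
have mS k : measurable (S k) by rewrite /S; case: ifP.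
have := Xind [set i; j]%SET S mS.
rewrite big_setU1 ?inE//= big_set1 /S eqxx eq_sym (negbTE ij) => <-.
congr (P _); apply/seteqP; split => t /=.
  move=> [Xi Xj] k /=; rewrite !inE => /orP[]/eqP ->; first by rewrite eqxx.
  by rewrite eq_sym (negbTE ij).
move=> H; split.
  by have := H i; rewrite /= !inE eqxx; apply.
by have := H j; rewrite /= !inE eqxx orbT eq_sym (negbTE ij); apply.
Qed.

(** The joint law agrees with the product of the marginal laws on rectangles, hence everywhere;
    Tonelli's theorem then factors the integral. *)
Lemma integral_independent_mul (X Y : {RV P >-> R}) (F G : R -> R) (a b : R) :
  (forall A B : set R, measurable A -> measurable B ->
    P (X @^-1` A `&` Y @^-1` B) = (P (X @^-1` A) * P (Y @^-1` B))%E) ->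
  measurable_fun [set: R] F -> (forall x, 0 <= F x) ->
  measurable_fun [set: R] G -> (forall x, 0 <= G x) ->
  (\int[P]_t (F (X t))%:E = a%:E)%E -> (\int[P]_t (G (Y t))%:E = b%:E)%E ->
  (\int[P]_t (F (X t) * G (Y t))%:E = (a * b)%:E)%E.
Proof.
move=> XY mF F0 mG G0 Fa Gb.
have mphi : measurable_fun [set: T] (fun t => (X t, Y t)).
  by apply/measurable_fun_pair; exact: measurable_funPT.
pose phi : {mfun T >-> (R * R)%type} :=
  HB.pack (fun t => (X t, Y t)) (isMeasurableFun.Build _ _ _ _ _ mphi).
pose H (z : R * R) := (F z.1 * G z.2)%:E.
have mH : measurable_fun [set: R * R] H.
  apply/measurable_EFinP; apply: measurable_funM; apply: measurableT_comp => //.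
have H0 z : (0 <= H z)%E by rewrite lee_fin mulr_ge0.
transitivity (\int[distribution P phi]_z H z)%E.
  by rewrite ge0_integral_distribution.
transitivity (\int[distribution P X \x distribution P Y]_z H z)%E.
  apply: eq_measure_integral => A mA _; apply/esym.
  by apply: product_measure_unique => // B C mB mC; exact: XY.
have mF' : measurable_fun [set: R] (EFin \o F) by exact/measurable_EFinP.
have mG' : measurable_fun [set: R] (EFin \o G) by exact/measurable_EFinP.
have F0' x : (0 <= (EFin \o F) x)%E by rewrite lee_fin.
have G0' x : (0 <= (EFin \o G) x)%E by rewrite lee_fin.
have b0 : (0 <= b%:E)%E by rewrite -Gb integral_ge0// => t _; exact: G0'.
rewrite fubini_tonelli1//.
transitivity (\int[distribution P X]_x ((EFin \o F) x * b%:E))%E.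
  apply: eq_integral => x _; rewrite /fubini_F/= -Gb.
  rewrite -[RHS](congr1 _ (ge0_integral_distribution Y mG' G0')).
  by rewrite -ge0_integralZl// ?lee_fin.
rewrite ge0_integralZr// (ge0_integral_distribution X mF' F0').
by rewrite [X in (X * _)%E]Fa EFinM.
Qed.

End independence.

(** * Mean and variance of a sample mean *)

Section sample_mean.
Context d (T : measurableType d) (R : realType) (P : probability T R).
Context (n : nat) (X : 'I_n -> {RV P >-> R}) (G : R -> R) (a b : R).
Hypothesis n_gt0 : (0 < n)%N.
Hypothesis X_indep : mutually_independent X.
Hypothesis mG : measurable_fun [set: R] G.
Hypothesis G_ge0 : forall x, 0 <= G x.
Hypothesis G_le1 : forall x, G x <= 1.
Hypothesis Ga : forall i, (\int[P]_t (G (X i t))%:E = a%:E)%E.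
Hypothesis Gb : forall i, (\int[P]_t (G (X i t) ^+ 2)%:E = b%:E)%E.

(** With [G y = box_cdf h (x - y)] this is the estimator at [x]. *)
Let S t := n%:R^-1 * \sum_(i < n) G (X i t).

Let mGX i : measurable_fun [set: T] (fun t => G (X i t)).
Proof. exact: measurableT_comp. Qed.

Let mS : measurable_fun [set: T] S.
Proof. by apply: measurable_funM => //; exact: measurable_sum. Qed.

Let nE : n%:R != 0 :> R. Proof. by rewrite pnatr_eq0 -lt0n. Qed.

Lemma expectation_sample_mean : ('E_P[S] = a%:E)%E.
Proof.
rewrite unlock; under eq_integral do rewrite EFinM -sumEFin.
rewrite ge0_integralZl_EFin ?invr_ge0//; last 2 first.
- by move=> t _; rewrite sume_ge0// => i _; rewrite lee_fin.
- by apply: emeasurable_sum => i; exact/measurable_EFinP.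
rewrite ge0_integral_sum//; last 2 first.
- by move=> i; exact/measurable_EFinP.
- by move=> i t _; rewrite lee_fin.
under eq_bigr do rewrite Ga.
by rewrite sumEFin -EFinM sumr_const card_ord -[a *+ n]mulr_natl mulKf.
Qed.

Let cov_sum : (\int[P]_t (S t ^+ 2)%:E =
  (n%:R ^- 2 * (n%:R * b + n%:R * (n%:R - 1) * a ^+ 2))%:E)%E.
Proof.
have SE t : S t ^+ 2 = n%:R ^- 2 * \sum_(i < n) \sum_(j < n) G (X i t) *
  G (X j t).
  rewrite /S exprMn exprVn; congr (_ * _); rewrite expr2 mulr_suml.
  by apply: eq_bigr => i _; rewrite mulr_sumr.
have mGG i j : measurable_fun [set: T] (fun t => (G (X i t) * G (X j t))%:E).
  by apply/measurable_EFinP; exact: measurable_funM.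
have GG0 i j t : (0 <= (G (X i t) * G (X j t))%:E)%E
  by rewrite lee_fin mulr_ge0.
under eq_integral do (rewrite SE EFinM -sumEFin;
  under eq_bigr do rewrite -sumEFin).
rewrite ge0_integralZl_EFin ?invr_ge0 ?exprn_ge0//; last 2 first.
- by move=> t _; rewrite sume_ge0// => i _; rewrite sume_ge0.
- by apply: emeasurable_sum => i; exact: emeasurable_sum.
rewrite ge0_integral_sum//; last 2 first.
- by move=> i; exact: emeasurable_sum.
- by move=> i t _; rewrite sume_ge0.
rewrite EFinM; congr (_ * _)%E.
(* Every term is [a^2], with a correction [b - a^2] on the diagonal, so the double sum needs no
   separate count of off-diagonal pairs. *)
transitivity (\sum_(i < n) \sum_(j < n)
    (a ^+ 2 + (if j == i then b - a ^+ 2 else 0))%:E)%E.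
  apply: eq_bigr => i _; rewrite ge0_integral_sum//.
  apply: eq_bigr => j _; have [->|ji] := eqVneq j i.
    by under eq_integral do rewrite -expr2; rewrite Gb addrC subrK.
  rewrite addr0 expr2; apply: integral_independent_mul => //.
  by move=> A B mA mB; apply: independent_pair => //; rewrite eq_sym.
under eq_bigr do rewrite sumEFin big_split/= -big_mkcond/= big_pred1_eq.
rewrite sumEFin sumr_const sumr_const !card_ord; congr EFin.
by rewrite -[LHS]mulr_natl -[a ^+ 2 *+ n]mulr_natl; ring.
Qed.

Lemma variance_sample_mean : ('V_P[S] = (n%:R^-1 * (b - a ^+ 2))%:E)%E.
Proof.
(* The bounds make [S] and [S * S] integrable, as required by the formula for the covariance. *)
have S01 t : 0 <= S t <= 1.
  rewrite /S mulr_ge0 ?invr_ge0 ?sumr_ge0//= mulrC ler_pdivrMr ?ltr0n// mul1r.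
  apply: le_trans (_ : \sum_(i < n) 1 <= _); first exact: ler_sum.
  by rewrite sumr_const card_ord.
have iS : S \in Lfun P 1.
  apply/Lfun1_integrable/(@bounded_integrable _ _ _ P _ 1) => // t.
  by have /andP[? ?] := S01 t; rewrite ger0_norm.
have iSS : (S * S)%R \in Lfun P 1.
  apply/Lfun1_integrable/(@bounded_integrable _ _ _ P _ 1).
    exact: measurable_funM.
  move=> t; have /andP[? ?] := S01 t; rewrite -[(S * S)%R t]/(S t * S t).
  by rewrite ger0_norm; [exact: mulr_ile1|exact: mulr_ge0].
rewrite /variance covarianceE// expectation_sample_mean unlock.
rewrite -EFinM; transitivity (\int[P]_t (S t ^+ 2)%:E - (a * a)%:E)%E => //.
by rewrite cov_sum -EFinB; congr EFin; field.
Qed.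

End sample_mean.

(** * Integrated squared bias and kernel variance for the uniform kernel *)

Section uniform_kernel.
Context {R : realType} (m : nat) (w c sigma : 'I_m -> R).
Hypothesis sigma_gt0 : forall j, 0 < sigma j.
Hypothesis w_gt0 : forall j, 0 < w j.
Hypothesis w_sum1 : \sum_(j < m) w j = 1.
Variable h : R.
Hypothesis h_gt0 : 0 < h.
Local Notation mu := (@lebesgue_measure R).
Local Notation f := (mixture_pdf w c sigma).
Local Notation g := (mixture_diff_pdf w c sigma).
Local Notation F := (mixture_cdf w c sigma).
Local Notation J := (mixture_J w c sigma).
Local Notation var_f := (mixture_var w c sigma).
Local Notation K := (box_cdf h).

Let mf : measurable_fun [set: R] f.
Proof. exact: measurable_mixture_pdf. Qed.

Let fE : has_integral f 1.
Proof. exact: has_integral_mixture_pdf. Qed.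

Let f0 x : 0 <= f x.
Proof. exact: mixture_pdf_ge0. Qed.

Let mK := @measurable_box_cdf R h.

Let integrable_bounded_mixture (G : R -> R) : measurable_fun [set: R] G ->
  (forall x, 0 <= G x <= 1) ->
  mu.-integrable [set: R] (EFin \o (fun y => G y * f y)).
Proof.
move=> mG G01; have [fi _] := fE.
apply: le_integrable fi => //; first exact/measurable_EFinP/measurable_funM.
move=> x _; have /andP[G0 G1] := G01 x.
by rewrite lee_fin !ger0_norm ?mulr_ge0// ler_piMl.
Qed.

Let mKx x : measurable_fun [set: R] (fun y => K (x - y)).
Proof. by apply: measurableT_comp => //; exact: measurable_funB. Qed.

Let K01 u : 0 <= K u <= 1.
Proof. by rewrite box_cdf_ge0// box_cdf_le1. Qed.

(** The first two moments of one summand of the estimator at [x], as integrals against the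
    density. *)
Definition smoothed_cdf x := \int[mu]_y (K (x - y) * f y).
Definition smoothed_sqr x := \int[mu]_y (K (x - y) ^+ 2 * f y).
Local Notation A := smoothed_cdf.
Local Notation B := smoothed_sqr.

Lemma has_integral_smoothed_cdf x : has_integral (fun y =>
  K (x - y) * f y) (A x).
Proof. by apply: integrable_has_integral;
  apply: integrable_bounded_mixture. Qed.

Lemma has_integral_smoothed_sqr x :
  has_integral (fun y => K (x - y) ^+ 2 * f y) (B x).
Proof.
apply: integrable_has_integral; apply: integrable_bounded_mixture.
  exact: measurable_funX.
by move=> y; rewrite sqr_ge0 expr_le1//; case/andP: (K01 (x - y)).
Qed.

Let KC u : K (- u) = 1 - K u.
Proof. by have := box_cdf_opp u h_gt0; lra. Qed.

Let hA' x : has_integral (fun y => K (y - x) * f y) (1 - A x).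
Proof.
apply: has_integral_eq (has_integralB fE
  (has_integral_smoothed_cdf x)) => // y.
by rewrite -(opprB x y) KC mulrBl mul1r.
Qed.

Let hF x : has_integral (fun y => tpow 0 (x - y) * f y) (F x).
Proof.
have i0 : mu.-integrable [set: R] (EFin \o (fun y => tpow 0 (x - y) * f y)).
  apply: integrable_bounded_mixture.
    by apply: measurableT_comp;
      [exact: measurable_tpow|exact: measurable_funB].
  by move=> y; rewrite tpow_ge0 /tpow expr0; case: ifP; rewrite ?lexx ?ler01.
have H := integrable_has_integral i0.
by rewrite /mixture_cdf (antiderivativeE H).
Qed.

Let hF' x : has_integral (fun y => tpow 0 (y - x) * f y) (1 - F x).
Proof. exact: has_integral_tpow0_compl fE (hF x). Qed.

Let gE : has_integral g 1.
Proof. exact: has_integral_mixture_diff_pdf. Qed.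

Let g2E : has_integral (fun t => t ^+ 2 * g t) (2 * var_f).
Proof. exact: has_integral_mixture_diff_sqr. Qed.

Let JE k x :
  has_integral (fun t => tpow k (x - t) * g t) (k`!%:R * J x (Negz k)).
Proof. exact: has_integral_mixture_J. Qed.

Let JE' k x :
  has_integral (fun t => tpow k (t + x) * g t) (k`!%:R * J x (Negz k)).
Proof. exact: has_integral_mixture_J_opp. Qed.

(** Existence comes from the normal components, the value from the symmetry of [g]. *)
Let gk k : odd k -> has_integral (fun t => t ^+ k * g t) 0.
Proof.
move=> ok; pose s i j := Num.sqrt (sigma i ^+ 2 + sigma j ^+ 2).
have s0 i j : 0 < s i j by rewrite sqrtr_gt0 addr_gt0// exprn_gt0.
have H := has_integral_mixture_diff w (fun i j =>
  integrable_has_integral (integrable_expr_normal k (c i - c j) (s0 i j))).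
by rewrite -[X in has_integral _ X](mixture_diff_odd sigma_gt0 ok H).
Qed.

(** Writing [tpow 2 (t - h)] as [(t - h)^2 - tpow 2 (h - t)] leaves two truncated moments, both
    given by [J] at [h], and a polynomial whose integral uses total mass 1, first moment 0 and
    second moment [2 * var_f]. *)
Let hL1 : has_integral
  (fun t => (tpow 2 (t + h) - tpow 2 (t - h)) / (4 * h) * g t)
  ((4 * J h (-3)%Z - 2 * var_f - h ^+ 2) / (4 * h)).
Proof.
have h1 := has_integralD (JE' 2 h) (JE 2 h).
have h2 := has_integralD (has_integralD g2E (has_integralZ (- (2 *
  h)) (gk (isT : odd 1))))
  (has_integralZ (h ^+ 2) gE).
have := has_integralZ (4 * h)^-1 (has_integralB h1 h2).
apply: has_integral_eq => [t|].
  have : (t - h) ^+ 2 = tpow 2 (t - h) + tpow 2 (h - t).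
    by rewrite (tpow_opp 1) sqrrN expr1n mul1r opprB.
  move=> /eqP; rewrite -subr_eq => /eqP <-; ring.
rewrite -[Negz 2]/(-3)%Z (_ : 2`! = 2)//; ring.
Qed.

(** Here [tpow 3 (t - 2 * h)] is [(t - 2 * h)^3 + tpow 3 (2 * h - t)], the sign coming from the odd
    exponent. In the expanded cube only [- 6 * h * t^2] and [- 8 * h^3] contribute. *)
Let hL2 : has_integral
  (fun t => (tpow 3 (t + 2 * h) - 2 * tpow 3 t + tpow 3 (t - 2 * h)) /
            (24 * h ^+ 2) * g t)
  ((12 * J (2 * h) (-4)%Z - 12 * J 0 (-4)%Z - 12 * h * var_f - 8 * h ^+ 3) /
   (24 * h ^+ 2)).
Proof.
have h1 := has_integralB (has_integralD (JE' 3 (2 * h)) (JE 3 (2 * h)))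
  (has_integralZ 2 (JE' 3 0)).
have h2 := has_integralD
  (has_integralD (gk (isT : odd 3)) (has_integralZ (- (6 * h)) g2E))
  (has_integralD (has_integralZ (12 * h ^+ 2) (gk (isT : odd 1)))
    (has_integralZ (- (8 * h ^+ 3)) gE)).
have := has_integralZ (24 * h ^+ 2)^-1 (has_integralD h1 h2).
apply: has_integral_eq => [t|].
  have : (t - 2 * h) ^+ 3 = tpow 3 (t - 2 * h) - tpow 3 (2 * h - t).
    by rewrite (tpow_opp 2) -signr_odd /= mulN1r opprB.
  move=> /eqP; rewrite eq_sym subr_eq => /eqP ->; rewrite addr0; ring.
rewrite -[Negz 3]/(-4)%Z (_ : 3`! = 6)//; ring.
Qed.

Let hL0 : has_integral (fun t => tpow 1 t * g t) (J 0 (-2)%Z).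
Proof.
apply: has_integral_eq (JE' 1 0) => [t|]; first by rewrite addr0.
by rewrite mul1r.
Qed.

Let mt k a : measurable_fun [set: R] (fun t => tpow k (t + a)).
Proof.
by apply: measurableT_comp; [exact: measurable_tpow|exact: measurable_funD].
Qed.

Let mL1 : measurable_fun [set: R]
  (fun t => (tpow 2 (t + h) - tpow 2 (t - h)) / (4 * h)).
Proof. by apply: measurable_funM => //; apply: measurable_funB. Qed.

Let mL2 : measurable_fun [set: R]
  (fun t => (tpow 3 (t + 2 * h) - 2 * tpow 3 t + tpow 3 (t - 2 * h)) /
            (24 * h ^+ 2)).
Proof.
apply: measurable_funM => //; apply: measurable_funD => //.
apply: measurable_funB => //; apply: measurable_funM => //.
exact: measurable_tpow.
Qed.

Let ff := mixture_pdf_correlation w c sigma_gt0.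

Lemma has_integral_bias_sqr : has_integral (fun x => (A x - F x) ^+ 2)
  (- (1 / (2 * h ^+ 2)) * (J (2 * h) (-4)%Z - J 0 (-4)%Z)
     + 2 / h * J h (-3)%Z - var_f / (2 * h) - h / 6 - J 0 (-2)%Z).
Proof.
have K0 u : 0 <= K u by case/andP: (K01 u).
have mt0 := @measurable_tpow R 0; have t00 := @tpow_ge0 R 0.
(* In each product the second factor is a complement, [1 - F] or [1 - A], because
   [has_integral_correlation] evaluates its second function at [Y - x]. *)
have AF := has_integral_correlation mf f0 mK K0 mt0 t00 mL1
  (@box_cdf_tpow0 R h) ff has_integral_smoothed_cdf hF' hL1.
have FA := has_integral_correlation mf f0 mt0 t00 mK K0 mL1
  (is_convolution_sym (@box_cdf_tpow0 R h)) ff hF hA' hL1.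
have AA := has_integral_correlation mf f0 mK K0 mK K0 mL2
  (@box_cdf_box_cdf R h) ff has_integral_smoothed_cdf hA' hL2.
have FF := has_integral_correlation mf f0 mt0 t00 mt0 t00 (@measurable_tpow R 1)
  (@tpow0_tpow0 R) ff hF hF' hL0.
have := has_integralB (has_integralD AF FA) (has_integralD AA FF).
apply: has_integral_eq => [x|]; first by ring.
by field; rewrite gt_eqF.
Qed.

Lemma has_integral_kernel_var : has_integral (fun x => B x - A x ^+ 2)
  (- (2 * h / 3) + 1 / (2 * h ^+ 2) * (J (2 * h) (-4)%Z - J 0 (-4)%Z)
   - var_f / (2 * h)).
Proof.
have K0 u : 0 <= K u by case/andP: (K01 u).
have AA := has_integral_correlation mf f0 mK K0 mK K0 mL2
  (@box_cdf_box_cdf R h) ff has_integral_smoothed_cdf hA' hL2.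
(* Since [1 - K u = K (- u)], the integral of [K * (1 - K)] is the convolution of [K] with itself at
   0, that is [(2 * h)^3 / (24 * h^2) = h / 3], whatever the value of [y]. *)
have AB : has_integral (fun x => A x - B x) (h / 3).
  apply: (@tonelli_has_integral R
    (fun z => K (z.1 - z.2) * K (z.2 - z.1) * f z.2) _ (fun y => h / 3 * f y)).
  - apply: measurable_funM; last exact: measurableT_comp.
    by apply: measurable_funM; apply: measurableT_comp => //;
      exact: measurable_funB.
  - by move=> z; rewrite mulr_ge0// mulr_ge0.
  - move=> x /=; have := has_integralB (has_integral_smoothed_cdf x)
      (has_integral_smoothed_sqr x).
    apply: has_integral_eq => // y.
    by rewrite -[X in _ = _ * K X * _](opprB x y) KC; ring.
  - move=> y /=; have := has_integralZ (f y)
      (has_integral_affine (- y) ltr01 (@box_cdf_box_cdf R h 0)).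
    apply: has_integral_eq => [x|].
      by rewrite mul1r sub0r opprD opprK [- y + x]addrC [y - x]addrC; ring.
    rewrite invr1 mul1r mulrC; congr (_ * _).
    rewrite add0r sub0r /tpow lexx oppr_ge0.
    rewrite pmulr_rge0 ?ltr0n// (ltW h_gt0) expr0n/= mulr0 subr0.
    by rewrite pmulr_rle0 ?ltr0n// leNgt h_gt0/=; field; rewrite gt_eqF.
  - by have := has_integralZ (h / 3) fE; rewrite mulr1.
have := has_integralB AA AB.
apply: has_integral_eq => [x|]; first by ring.
by field; rewrite gt_eqF.
Qed.

End uniform_kernel.

(** * Transfer to the kernel estimator *)

Unset Implicit Arguments.

Theorem theorem3 (R : realType) (d : measure_display) (T : measurableType d)
    (P : probability T R) (m n : nat) (w mu sigma : 'I_m -> R)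
    (X : 'I_n -> {RV P >-> R})
    (m_ge1 : (1 <= m)%N) (n_ge1 : (1 <= n)%N)
    (sigma_gt0 : forall j, 0 < sigma j)
    (w_gt0 : forall j, 0 < w j)
    (w_sum1 : \sum_(j < m) w j = 1)
    (X_indep : mutually_independent X)
    (X_density : forall i, has_density (X i) (mixture_pdf w mu sigma))
    (h : R) (h_gt0 : 0 < h) :
  let F := mixture_cdf w mu sigma in
  let Fhat := kernel_cdf_estimator X h in
  let J := mixture_J w mu sigma in
  let var_f := mixture_var w mu sigma in
  ISB P Fhat F =
    (- (1 / (2 * h ^+ 2)) * (J (2 * h) (-4)%Z - J 0 (-4)%Z)
     + 2 / h * J h (-3)%Z
     - var_f / (2 * h)
     - h / 6
     - J 0 (-2)%Z)%:E
  /\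
  IV P Fhat =
    (- (2 * h / (3 * n%:R))
     + 1 / (2 * h ^+ 2 * n%:R) * (J (2 * h) (-4)%Z - J 0 (-4)%Z)
     - var_f / (2 * h * n%:R))%:E.
Proof.
move=> F Fhat J var_f.
pose A := smoothed_cdf w mu sigma h; pose B := smoothed_sqr w mu sigma h.
have mf : measurable_fun [set: R] (mixture_pdf w mu sigma).
  exact: measurable_mixture_pdf.
have FhatE x : Fhat x =
    fun t => n%:R^-1 * \sum_(i < n) box_cdf h (x - X i t).
  apply/funext => t; rewrite /Fhat /kernel_cdf_estimator; congr (_ * _).
  by apply: eq_bigr => i _; exact: unif_kernel_cdfE.
have mK x : measurable_fun [set: R] (fun y => box_cdf h (x - y)).
  apply: measurableT_comp; [exact: measurable_box_cdf|exact: measurable_funB].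
have K0 x y : 0 <= box_cdf h (x - y) by exact: box_cdf_ge0.
have K1 x y : box_cdf h (x - y) <= 1 by exact: box_cdf_le1.
have EA x i : (\int[P]_t (box_cdf h (x - X i t))%:E = (A x)%:E)%E.
  apply: (@integral_has_density _ _ _ P (X i) _ _ 1 _ mf (X_density i) (mK x)).
    by move=> y; rewrite ger0_norm.
  exact: has_integral_smoothed_cdf.
have EB x i : (\int[P]_t (box_cdf h (x - X i t) ^+ 2)%:E = (B x)%:E)%E.
  apply: (@integral_has_density _ _ _ P (X i) _ (fun y =>
    box_cdf h (x - y) ^+ 2)
    1 _ mf (X_density i)).
  - exact: measurable_funX.
  - by move=> y; rewrite ger0_norm ?sqr_ge0// expr_le1.
  - exact: has_integral_smoothed_sqr.
split.
- have [_ <-] := has_integral_bias_sqr mu sigma_gt0 w_gt0 w_sum1 h_gt0.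
  rewrite /ISB; apply: eq_integral => x _.
  by rewrite FhatE (expectation_sample_mean n_ge1 (mK x) (K0 x) (EA x)).
(* The variance of the estimator at [x] is [(B x - A x ^+ 2) / n], so the integral of [B - A^2] is
   scaled by [n^-1]. *)
- have [_ IV] := has_integralZ n%:R^-1
    (has_integral_kernel_var mu sigma_gt0 w_gt0 w_sum1 h_gt0).
  transitivity (n%:R^-1 * (- (2 * h / 3) +
    1 / (2 * h ^+ 2) * (J (2 * h) (-4)%Z - J 0 (-4)%Z) - var_f / (2 * h)))%:E.
    rewrite -IV; apply: eq_integral => x _.
    by rewrite FhatE (variance_sample_mean n_ge1 X_indep (mK x) (K0 x) (K1 x)
      (EA x) (EB x)).
  by congr EFin; field; rewrite pnatr_eq0 -lt0n n_ge1 gt_eqF.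
Qed.
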